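(* Let $p\in(0,1)\cup(1,\infty)$ and $0\le\varphi\in C_b^2(\mathbb{R}^N)$. Assume that $H$ satisfies the basic assumption and the $p$-condition (with constants $a,b,\gamma>0$). For $\varepsilon>0$ let $v_\varepsilon$ be the solution to $$\partial_t v_\varepsilon-\varepsilon\Delta v_\varepsilon+H(|\nabla v_\varepsilon|)=0\ \text{ in }\mathbb{R}^N\times(0,\infty),\qquad v_\varepsilon(x,0)=\varphi(x),\ x\in\mathbb{R}^N.$$ Then $$\|\nabla_x v_\varepsilon(\cdot,t)\|_\infty\le\lambda_p\,\|\varphi\|_\infty^{1/p}\,(at)^{-1/p},\qquad t>0,$$ where $\lambda_p=1$ if $p>1$ and $\lambda_p=(2/p)^{1/p}$ if $p<1$. In addition, if $p>1$, $$\left\|\nabla_x\left(v_\varepsilon^{\frac{p-1}{p}}\right)(\cdot,t)\right\|_\infty\le\mu_p\,t^{-1/p},\qquad t>0,$$ where $\mu_p=(p-1)a^{-1/p}/p$. Moreover there is $\varepsilon_0>0$ depending only on $p$ and $N$ such that the following hold. (1) For $0<\varepsilon<\varepsilon_0$ and $(x,t)\in\mathbb{R}^N\times(0,\infty)$, $$\partial_t v_\varepsilon(x,t)\le 2^{\frac{p+1}{p}}\,N\,\lambda_p\,\|\varphi\|_\infty^{1/p}\,a^{-1/p}\,\varepsilon^{1/2}\,t^{-\frac{p+2}{2p}}.$$ (2) If in addition $H(r)\le g_H(r^{\kappa_\infty}+r^{\kappa_0})$ for $0<r<\infty$, with constants $g_H>0$ and $0<\kappa_\infty\le\kappa_0$,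 then for all $0<\varepsilon<\varepsilon_0$ and $(x,t)\in\mathbb{R}^N\times(0,\infty)$, $$\partial_t v_\varepsilon(x,t)\ge -L\,t^{-\mu}-2^{\frac{p+1}{p}}\,N\,\lambda_p\,\|\varphi\|_\infty^{1/p}\,a^{-1/p}\,\varepsilon^{1/2}\,t^{-\frac{p+2}{2p}},$$ where $\mu=\kappa_0/p$ if $0<t\le1$, $\mu=\kappa_\infty/p$ if $1<t<\infty$, and $$L=g_H\left\{\left(2\lambda_p^p\|\varphi\|_\infty a^{-1}\right)^{\kappa_0/p}+\left(2\lambda_p^p\|\varphi\|_\infty a^{-1}\right)^{\kappa_\infty/p}\right\}.$$
   Context: $C_b^2(\mathbb{R}^N)$ is the space of twice continuously differentiable functions on $\mathbb{R}^N$ that are bounded together with all their derivatives up to second order; $\|\cdot\|_\infty$ is the $L^\infty(\mathbb{R}^N)$ norm. Basic assumption on $H$: $H:[0,\infty)\to[0,\infty)$ is continuous, $H(0)=0$, $H$ is locally Lipschitz continuous on $(0,\infty)$, and there is a family $\{\Phi_\eta\}_{\eta>0}$ of nonnegative smooth functions on $[0,\infty)$ such that $\Phi_\eta(0)=0$ for all $\eta>0$ and $\Phi_\eta(r^2)\to H(r)$ as $\eta\to0^+$ uniformly on compact intervals of $[0,\infty)$. $p$-condition: set $\Theta_\eta(r)=2r\Phi_\eta'(r)-\Phi_\eta(r)$. There exist $\gamma>0$, $a>0$, $b>0$ such that, for all $r>0$ and all sufficiently small $\eta>0$: $\Theta_\eta(r)\ge a r^{p/2}-b\eta^\gamma$ if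 $p>1$; $\Theta_\eta(r)\le -a r^{p/2}+b\eta^\gamma$ if $p<1$. The constant $a$ in the estimates is the one from this condition. It is known that for $0\le\varphi\in C_b^2(\mathbb{R}^N)$ the Cauchy problem has a unique global solution $v_\varepsilon$ with: $v_\varepsilon\in C^{2,1}(\mathbb{R}^N\times[0,\infty))$ (twice continuously differentiable in $x$, once in $t$), $0\le v_\varepsilon\le\|\varphi\|_\infty$, and $\|\nabla_x v_\varepsilon(\cdot,t)\|_\infty\le\|\nabla_x\varphi\|_\infty$ for $t>0$; this is the solution $v_\varepsilon$ meant in the claim. *)

(* Defs.v *)
From HB Require Import structures.
From mathcomp Require Import all_boot all_order all_algebra.
From mathcomp Require Import all_classical all_reals all_analysis.
Import Order.TTheory GRing.Theory Num.Theory.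
Import numFieldNormedType.Exports.

Set Implicit Arguments.
Unset Strict Implicit.
Unset Printing Implicit Defensive.

Local Open Scope classical_set_scope.
Local Open Scope ring_scope.

Section Calculus.
Context {R : realType} {N : nat}.
Implicit Types (f : 'rV[R]_N -> R) (x u : 'rV[R]_N).

Definition has_partial (i : 'I_N) f x := derivable f x (delta_mx 0 i).

Definition partial (i : 'I_N) f x : R := 'D_(delta_mx 0 i) f x.

Definition grad f x : 'rV[R]_N := \row_i partial i f x.

Definition laplacian f x : R := \sum_(i < N) partial i (partial i f) x.

(* The library's norm on 'rV[R]_N is the max norm, hence this one. *)
Definition enorm u : R := Num.sqrt (\sum_(i < N) u 0 i ^+ 2).

Definition C2b f :=
  [/\ continuous f /\ bounded_fun f,
      forall i, [/\ forall x, has_partial i f x, continuous (partial i f)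
                  & bounded_fun (partial i f)]
    & forall i j, [/\ forall x, has_partial j (partial i f) x,
                      continuous (partial j (partial i f))
                    & bounded_fun (partial j (partial i f))]].

(* Lebesgue-null sets of R^N, through coverings by countably many boxes of
   arbitrarily small total volume. *)
Definition null_set (A : set 'rV[R]_N) :=
  forall e : R, 0 < e -> exists a b : nat -> 'rV[R]_N,
    [/\ forall k i, a k 0 i <= b k 0 i,
        A `<=` \bigcup_k
          [set x : 'rV[R]_N | forall i, a k 0 i <= x 0 i <= b k 0 i]
      & (\sum_(0 <= k <oo) (\prod_(i < N) (b k 0 i - a k 0 i))%:E <= e%:E)%E].

(* The L^infty norm: essential supremum of |f|, +oo if there is no essential
   bound. *)
Definition Linf_norm f : \bar R :=
  ereal_inf (EFin @` [set M | null_set [set x | M < `|f x|]]).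

Definition grad_norm f : \bar R := Linf_norm (fun x => enorm (grad f x)).

End Calculus.

Section HalfLine.
Context {R : realType}.

(* l is the derivative at t of f regarded as a function on [0, +oo): two-sided
   for t > 0, from the right for t = 0. *)
Definition is_derive_half (f : R -> R) (t l : R) :=
  h^-1 * (f (t + h) - f t) @[h --> within [set h | 0 <= t + h] 0^'] --> l.

(* C^infty up to and including the endpoint 0; g n is the n-th derivative. *)
Definition smooth_half (f : R -> R) :=
  exists2 g : nat -> R -> R, forall t, 0 <= t -> g 0%N t = f t
    & forall n t, 0 <= t -> is_derive_half (g n) t (g n.+1 t).

End HalfLine.

Section Hamiltonian.
Context {R : realType}.
Implicit Types (H : R -> R) (Phi : R -> R -> R).

Definition basic_assumption H Phi :=
  [/\ [/\ forall r, 0 <= r -> 0 <= H r,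
          {within `[0, +oo[, continuous H}, H 0 = 0
        & forall r : R, 0 < r ->
            exists2 U : set R, nbhs (r : R) U & [lipschitz H s | s in U]],
      forall eta, 0 < eta ->
        [/\ forall r, 0 <= r -> 0 <= Phi eta r, smooth_half (Phi eta)
          & Phi eta 0 = 0]
    & forall c d : R, 0 <= c ->
        {uniform `[c, d], (fun eta r => Phi eta (r ^+ 2)) @ 0^'+ --> H}].

Definition Theta Phi (eta r : R) : R := 2 * r * derive1 (Phi eta) r - Phi eta r.

Definition p_condition (p : R) Phi (a b gamma : R) :=
  [/\ 0 < a, 0 < b, 0 < gamma,
      1 < p -> \forall eta \near 0^'+, forall r, 0 < r ->
        a * r `^ (p / 2) - b * eta `^ gamma <= Theta Phi eta r
    & p < 1 -> \forall eta \near 0^'+, forall r, 0 < r ->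
        Theta Phi eta r <= - a * r `^ (p / 2) + b * eta `^ gamma].

End Hamiltonian.

Section Cauchy.
Context {R : realType} {N : nat}.
Implicit Types (v : 'rV[R]_N -> R -> R) (phi : 'rV[R]_N -> R).

Definition continuous_half_space v :=
  {within [set z : 'rV[R]_N * R | 0 <= z.2],
    continuous (fun z : 'rV[R]_N * R => v z.1 z.2)}.

(* C^{2,1}(R^N x [0, +oo)); the values of v at negative times play no role. *)
Definition C21 v :=
  [/\ continuous_half_space v,
      forall i, (forall x t, 0 <= t -> has_partial i (v ^~ t) x) /\
        continuous_half_space (fun x t => partial i (v ^~ t) x),
      forall i j,
        (forall x t, 0 <= t -> has_partial j (partial i (v ^~ t)) x) /\
        continuous_half_space (fun x t => partial j (partial i (v ^~ t)) x)
    & exists2 vt : 'rV[R]_N -> R -> R,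
        forall x t, 0 <= t -> is_derive_half (v x) t (vt x t)
      & continuous_half_space vt].

Definition solution (H : R -> R) (eps : R) phi v :=
  [/\ C21 v,
      forall x t, 0 < t ->
        derive1 (v x) t - eps * laplacian (v ^~ t) x
          + H (enorm (grad (v ^~ t) x)) = 0,
      forall x, v x 0 = phi x,
      forall x t, 0 <= t -> 0 <= v x t /\ ((v x t)%:E <= Linf_norm phi)%E
    & forall t, 0 < t -> (grad_norm (v ^~ t) <= grad_norm phi)%E].

End Cauchy.

Section Constants.
Context {R : realType}.

Definition lambda_ (p : R) : R := if 1 < p then 1 else (2 / p) `^ p^-1.

Definition mu_ (p a : R) : R := (p - 1) * a `^ (- p^-1) / p.

End Constants.

(* Main.v *)
(* Everything is a doubling of variables, which needs only two space derivatives
   of [v].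

   The p-condition says that H(r) / r - a r^(p-1) / abs(p-1) is nondecreasing in r
   if p > 1, nonincreasing if p < 1.  If U' = 1 / g with g concave, then
   u = U(v) satisfies
     u_t = eps Lap u + eps g'(v) |grad u|^2 - H(g(v) |grad u|) / g(v),
   and at a positive maximum of u(x,t) - u(y,t) - L(t) |x - y| the two gradients
   agree, the Laplacians compare through translations, and the last term gains
   c L^p (u(x) - u(y)).  This is impossible if L' = - c L^(p+1), so u is
   Lipschitz with constant (p c t)^(-1/p).  The choices g = q (v + d)^(1/p) with
   q = p / (p - 1), and g = sqrt(2 (M + d - v)), give the gradient bounds.

   For the time derivative one compares v(x, t0 + mu^2 s) with v(y, t0 + s) for
   mu > 1: where their difference minus A |x - y|^2 is maximal the gradients
   agree, so the Hamiltonians nearly cancel, and testing the second derivative in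
   the directions (mu e_i, e_i) costs only 2 N A eps (mu - 1)^2.  Letting mu tend
   to 1 with A of order 1 / (mu^2 - 1) bounds v_t from both sides, for every
   eps > 0. *)

(* The space is unbounded, so each comparison function carries two extra terms: a penalty
   [sg |x|^2], which confines its positive values to a box, and a slope [kap] in time, which turns
   the weak inequality at a maximum into a contradiction. The penalty shifts one of the two
   gradients by [2 sg x]; since [H] is merely continuous up to 0, this shift is absorbed by uniform
   continuity and not by a Lipschitz bound.

   The derivative [1 / g] of the transform would blow up at [v = 0] if [p > 1] and at [v = M] if
   [p < 1]. The shift [d > 0] keeps [g] between positive constants; [d] is sent to 0 only in the
   final estimates, whose constants converge.

   A further obstacle is that [v^((p-1)/p)] may fail to be differentiable at a zero of [v]. A third,
   logarithmic transform rules out isolated zeros: at each positive time [v] vanishes identically or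
   is positive everywhere.

   The lower bound on [v_t] is the upper bound for [- v], which solves the equation with [- H]; for
   this reason the part on time derivatives assumes no sign of the Hamiltonian. *)
Require Import Defs.
From mathcomp Require Import all_boot all_order all_algebra.
From mathcomp Require Import all_classical all_reals all_analysis.
From mathcomp Require Import ring lra.
Import Order.TTheory GRing.Theory Num.Theory.
Import numFieldNormedType.Exports.

Local Open Scope classical_set_scope.
Local Open Scope ring_scope.

(** * One-variable calculus along lines and at maxima *)

Section RealLine.
Context {R : realType}.
Implicit Types f w : R -> R.

Lemma is_derive_line {V : normedModType R} (f : V -> R) (x v : V) (h l : R) :
  is_derive (x + h *: v) v f l <-> is_derive h 1 (fun k => f (x + k *: v)) l.
Proof.
pose g k := f (x + k *: v).
have E : (fun k : R => k^-1 *: ((f \o shift (x + h *: v)) (k *: v)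
    - f (x + h *: v))) =
  (fun k : R => k^-1 *: ((g \o shift h) (k *: 1) - g h)).
  apply/funext => k; rewrite /g /=.
  by rewrite scalerDl [k *: 1]mulr1 addrCA addrA.
split=> -[]; rewrite /derivable /derive.
  by rewrite E => dfx lE; apply: DeriveDef.
by rewrite -E => dfx lE; apply: DeriveDef.
Qed.

Lemma is_derive_lineP {V : normedModType R} (f df : V -> R) (x v : V) :
  (forall y, is_derive y v f (df y)) ->
  forall h : R, is_derive h 1 (fun k => f (x + k *: v)) (df (x + h *: v)).
Proof.
move=> dfP h; have [+ _] := is_derive_line f x v h (df (x + h *: v)).
by apply; exact: dfP.
Qed.

(** A maximum over a time interval may sit at its right end, so only left difference quotients are
    available and they yield a sign instead of a vanishing derivative. *)
Lemma derive_ge0_left f (t l : R) : 0 < t -> is_derive t 1 f l ->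
  (forall s, 0 <= s <= t -> f s <= f t) -> 0 <= l.
Proof.
move=> t0 [/cvg_ex[l' fl'] <-] fmax; rewrite /derive (cvg_lim _ fl')//.
have fl := cvg_dnbhs_at_left fl'.
apply: (cvgr_to_ge fl); near=> h.
have h0 : h < 0 by near: h; exact: nbhs_left_lt.
have th : - t < h by near: h; apply: nbhs_left_gt; rewrite oppr_lt0.
rewrite /= [h *: 1]mulr1; apply: mulr_le0; first by rewrite invr_le0 ltW.
rewrite subr_le0; apply: fmax.
by apply/andP; split; lra.
Unshelve. all: by end_near. Qed.

(** Since [w1] is differentiable at 0 only, no Taylor expansion is used: if [w2 > 0], then
    [w1 > w1 0 = 0] just to the right of 0, and the mean value theorem makes [w] exceed [w 0]
    there. *)
Lemma second_derivative_max w (w1 : R -> R) (w2 : R) :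
  (forall h : R, is_derive h 1 w (w1 h)) -> is_derive (0 : R) 1 w1 w2 ->
  (forall h, w h <= w 0) -> w1 0 = 0 /\ w2 <= 0.
Proof.
move=> dw dw1 wmax.
have w10 : w1 0 = 0.
  have N11 : (-1 : R) <= 1 by lra.
  have dw' t : t \in `](-1), 1[ -> derivable w t 1 by move=> _; case: (dw t).
  have i0 : (0 : R) \in `](-1), 1[ by rewrite in_itv/=; lra.
  have [_ d0] := derive1_at_max N11 dw' i0 (fun t _ => wmax t).
  by have [_ <-] := dw 0.
split=> //; rewrite leNgt; apply/negP => w20.
case: dw1 => /cvg_ex[l fl] lE; move: lE; rewrite /derive (cvg_lim _ fl)// => lE.
move: fl; rewrite lE => /cvg_dnbhs_at_right/cvgr_gt/(_ _ w20) [d /= d0 dP].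
have d2 : 0 < d / 2 by rewrite divr_gt0.
have cw : {within `[0, d / 2], continuous w}.
  by apply: derivable_within_continuous => h _; case: (dw h).
have [c] := MVT d2 (fun h _ => dw h) cw.
rewrite in_itv/= => /andP[c0 cd] cE.
have := dP c; rewrite /= w10 subr0 [c *: 1]mulr1 addr0 sub0r normrN gtr0_norm//.
move=> /(_ _ c0); rewrite [_ *: _]mulrC pmulr_lgt0 ?invr_gt0//.
have cd' : c < d by lra.
move=> /(_ cd') w1c; have := wmax (d / 2).
by rewrite -subr_le0 cE subr0 leNgt mulr_gt0.
Qed.


Lemma is_derive_ge0_le f (df : R -> R) (a b : R) : a <= b ->
  (forall s, a <= s <= b -> is_derive s 1 f (df s)) ->
  (forall s, a <= s <= b -> 0 <= df s) -> f a <= f b.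
Proof.
move=> ab dfP df0.
have cf : {within `[a, b], continuous f}.
  by apply: derivable_within_continuous => s; rewrite in_itv/= => /dfP[].
have dfP' s : s \in `]a, b[ -> is_derive s 1 f (df s).
  by rewrite in_itv/= => /andP[/ltW h1 /ltW h2]; apply: dfP; rewrite h1.
have [s] := MVT_segment ab dfP' cf.
by rewrite in_itv/= => sab fE; rewrite -subr_ge0 fE mulr_ge0 ?df0// subr_ge0.
Qed.

End RealLine.

(** * The Euclidean norm on row vectors *)

Section EuclideanNorm.
Context {R : realType} {N : nat}.
Implicit Types (u v x y z : 'rV[R]_N) (i : 'I_N).

Lemma enorm_ge0 u : 0 <= enorm u.
Proof. exact: sqrtr_ge0. Qed.

Lemma sqr_enorm u : enorm u ^+ 2 = \sum_i u 0 i ^+ 2.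
Proof. by rewrite sqr_sqrtr// sumr_ge0// => i _; rewrite sqr_ge0. Qed.

Lemma coord_le_enorm u i : `|u 0 i| <= enorm u.
Proof.
rewrite -(@ler_pXn2r _ 2)// ?nnegrE ?enorm_ge0// real_normK ?num_real//.
rewrite sqr_enorm (bigD1 i)//= lerDl sumr_ge0// => j _; exact: sqr_ge0.
Qed.

Lemma enorm0 : enorm (0 : 'rV[R]_N) = 0.
Proof. by rewrite /enorm big1 ?sqrtr0// => i _; rewrite mxE expr0n. Qed.

Lemma enorm_eq0 u : enorm u = 0 -> u = 0.
Proof.
move=> u0; apply/rowP => i; rewrite mxE; apply/eqP.
by rewrite -normr_le0 -u0 coord_le_enorm.
Qed.

Lemma enormZ (k : R) u : enorm (k *: u) = `|k| * enorm u.
Proof.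
rewrite /enorm -sqrtr_sqr -sqrtrM ?sqr_ge0// mulr_sumr; congr Num.sqrt.
by apply: eq_bigr => i _; rewrite mxE exprMn.
Qed.

Lemma enormN u : enorm (- u) = enorm u.
Proof. by rewrite -scaleN1r enormZ normrN1 mul1r. Qed.

(** Cauchy-Schwarz, by expanding the squares of [|v| u_i - |u| v_i] and dividing by [2 |u| |v|]. *)
Lemma dot_le_enorm u v : \sum_i u 0 i * v 0 i <= enorm u * enorm v.
Proof.
have [u0|u0] := eqVneq (enorm u) 0.
  rewrite (enorm_eq0 u u0) enorm0 mul0r big1// => i _; by rewrite mxE mul0r.
have [v0|v0] := eqVneq (enorm v) 0.
  rewrite (enorm_eq0 v v0) enorm0 mulr0 big1// => i _; by rewrite mxE mulr0.
have uv : 0 < enorm u * enorm v by rewrite mulr_gt0// lt0r enorm_ge0 ?u0 ?v0.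
have : 0 <= \sum_i (enorm v * u 0 i - enorm u * v 0 i) ^+ 2.
  by apply: sumr_ge0 => i _; exact: sqr_ge0.
have -> : \sum_i (enorm v * u 0 i - enorm u * v 0 i) ^+ 2 =
    2 * (enorm u * enorm v) * (enorm u * enorm v - \sum_i u 0 i * v 0 i).
  transitivity (enorm v ^+ 2 * (enorm u ^+ 2) + enorm u ^+ 2 * (enorm v ^+ 2)
      - 2 * (enorm u * enorm v) * \sum_i u 0 i * v 0 i); last by ring.
  rewrite {1}(sqr_enorm u) {2}(sqr_enorm v) !mulr_sumr -sumrN -!big_split/=.
  by apply: eq_bigr => i _; ring.
by rewrite pmulr_rge0 ?subr_ge0// mulr_gt0.
Qed.

Lemma enormD u v : enorm (u + v) <= enorm u + enorm v.
Proof.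
rewrite -(@ler_pXn2r _ 2)// ?nnegrE ?addr_ge0 ?enorm_ge0//.
have -> : enorm (u + v) ^+ 2 =
    enorm u ^+ 2 + enorm v ^+ 2 + 2 * \sum_i u 0 i * v 0 i.
  rewrite !sqr_enorm mulr_sumr -!big_split/=.
  by apply: eq_bigr => i _; rewrite mxE; ring.
by have := dot_le_enorm u v; nra.
Qed.

Lemma enorm_dist u v : `|enorm (u + v) - enorm u| <= enorm v.
Proof.
rewrite ler_norml; apply/andP; split; last by rewrite lerBlDl enormD.
have := enormD (u + v) (- v); rewrite addrK enormN; lra.
Qed.

Lemma enorm_continuous : continuous (@enorm R N).
Proof.
move=> u; apply: (@continuous_comp _ _ _ _ Num.sqrt); last exact: sqrt_continuous.
apply: continuous_big => [|i _]; first exact: add_continuous.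
move=> {}u; have c := @coord_continuous R 1 N 0 i u.
exact: (cvgM c c).
Qed.

Lemma sqr_enorm_line u (h : R) i :
  enorm (u + h *: delta_mx 0 i) ^+ 2 = enorm u ^+ 2 + 2 * h * u 0 i + h ^+ 2.
Proof.
rewrite !sqr_enorm (bigD1 i)//= [in RHS](bigD1 i)//=.
rewrite !mxE !eqxx/= (eq_bigr (fun j => u 0 j ^+ 2)); first by ring.
by move=> j ji; rewrite !mxE (negbTE ji) andbF mulr0 addr0.
Qed.

Lemma continuous_enorm (T : topologicalType) (f : T -> 'rV[R]_N) :
  continuous f -> continuous (fun p => enorm (f p)).
Proof.
move=> cf p; apply: (@continuous_comp _ _ _ f (@enorm R N)); first exact: cf.
exact: enorm_continuous.
Qed.

End EuclideanNorm.

(** * First and second order conditions at a maximum in doubled variables *)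

Section DoublingOfVariables.
Context {R : realType} {N : nat}.
Implicit Types (P Q : 'rV[R]_N -> R) (x y : 'rV[R]_N) (i : 'I_N).
Let e i : 'rV[R]_N := delta_mx 0 i.

(** The pair is moved along [(al e_i, be e_i)], which reduces everything to the one-variable test at
    [h = 0]. The coupling term feels only the relative speed [al - be], hence the factor
    [(al - be)^2]. *)
Lemma doubling_line P P1 Q Q1 (P2 Q2 : R) i x y (al be A s : R) :
  (forall z, is_derive z (e i) P (P1 z)) -> is_derive x (e i) P1 P2 ->
  (forall z, is_derive z (e i) Q (Q1 z)) -> is_derive y (e i) Q1 Q2 ->
  (forall x' y',
    P x' - Q y' - A * enorm (x' - y') ^+ 2 - s * enorm x' ^+ 2 <=
    P x - Q y - A * enorm (x - y) ^+ 2 - s * enorm x ^+ 2) ->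
  al * (P1 x - 2 * A * (x - y) 0 i - 2 * s * x 0 i)
    = be * (Q1 y - 2 * A * (x - y) 0 i) /\
  al ^+ 2 * P2 - be ^+ 2 * Q2 <=
    2 * A * (al - be) ^+ 2 + 2 * s * al ^+ 2.
Proof.
move=> dP dP1 dQ dQ1 xymax.
(* Both squared norms are written out as polynomials in [h], so that only [P] and [Q] need the chain
   rule. *)
pose w (h : R) := P (x + (al * h) *: e i) - Q (y + (be * h) *: e i)
  - A * (enorm (x - y) ^+ 2 + 2 * ((al - be) * h) * (x - y) 0 i
         + ((al - be) * h) ^+ 2)
  - s * (enorm x ^+ 2 + 2 * (al * h) * x 0 i + (al * h) ^+ 2).
pose w1 (h : R) := al * P1 (x + (al * h) *: e i) - be * Q1 (y + (be * h) *: e i)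
  - A * (2 * (al - be) * (x - y) 0 i + 2 * (al - be) ^+ 2 * h)
  - s * (2 * al * x 0 i + 2 * al ^+ 2 * h).
have dlin (k h : R) : is_derive h 1 (fun h => k * h) k.
  by apply: is_derive_eq; rewrite [_ *: _]mulr1.
have dcomp (f : 'rV[R]_N -> R) f1 z (k h : R) :
    is_derive (z + (k * h) *: e i) (e i) f f1 ->
    is_derive h 1 (fun h => f (z + (k * h) *: e i)) (k * f1).
  move=> df; have [+ _] := is_derive_line f z (e i) (k * h) f1.
  by move/(_ df) => d1; rewrite mulrC; exact: (is_derive1_comp d1 (dlin k h)).
have dw (h : R) : is_derive h 1 w (w1 h).
  have := dcomp P _ x al h (dP _); have := dcomp Q _ y be h (dQ _).
  have := dlin al h; have := dlin be h; have := dlin (al - be) h.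
  move=> d1 d2 d3 dQh dPh; rewrite /w /w1.
  apply: is_derive_eq; rewrite /GRing.scale/=.
  ring.
have dw1 : is_derive (0 : R) 1 w1
   (al ^+ 2 * P2 - be ^+ 2 * Q2 - 2 * A * (al - be) ^+ 2 - 2 * s * al ^+ 2).
  have dP0 : is_derive (x + (al * 0) *: e i) (e i) P1 P2.
    by rewrite mulr0 scale0r addr0.
  have dQ0 : is_derive (y + (be * 0) *: e i) (e i) Q1 Q2.
    by rewrite mulr0 scale0r addr0.
  have := dcomp P1 _ x al 0 dP0; have := dcomp Q1 _ y be 0 dQ0.
  move=> dQh dPh; rewrite /w1.
  apply: is_derive_eq; rewrite /GRing.scale/=.
  ring.
have wmax h : w h <= w 0.
  have := xymax (x + (al * h) *: e i) (y + (be * h) *: e i).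
  have -> : x + (al * h) *: e i - (y + (be * h) *: e i) =
      (x - y) + ((al - be) * h) *: e i.
    by rewrite mulrBl scalerBl opprD addrACA.
  by rewrite !sqr_enorm_line /w !mulr0 !scale0r !addr0 !mul0r expr0n !addr0.
have [] := second_derivative_max w w1 _ dw dw1 wmax.
rewrite /w1 !mulr0 !scale0r !addr0.
by split; lra.
Qed.

(** The directions [(1, 0)] and [(0, 1)] identify the two gradients separately. The second-order
    pair stays free: [(1, 1)] cancels the coupling term, while [(mu, 1)] serves the comparison at
    two time scales. *)
Lemma doubling_test P P1 Q Q1 (P2 Q2 : R) i x y (al be A s : R) :
  (forall z, is_derive z (e i) P (P1 z)) -> is_derive x (e i) P1 P2 ->
  (forall z, is_derive z (e i) Q (Q1 z)) -> is_derive y (e i) Q1 Q2 ->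
  (forall x' y',
    P x' - Q y' - A * enorm (x' - y') ^+ 2 - s * enorm x' ^+ 2 <=
    P x - Q y - A * enorm (x - y) ^+ 2 - s * enorm x ^+ 2) ->
  [/\ P1 x = 2 * A * (x - y) 0 i + 2 * s * x 0 i,
      Q1 y = 2 * A * (x - y) 0 i
    & al ^+ 2 * P2 - be ^+ 2 * Q2 <=
        2 * A * (al - be) ^+ 2 + 2 * s * al ^+ 2].
Proof.
move=> dP dP1 dQ dQ1 xymax.
have dbl a b := doubling_line P P1 Q Q1 P2 Q2 i x y a b A s dP dP1 dQ dQ1 xymax.
have [+ _] := dbl 1 0; have [+ _] := dbl 0 1; have [_ ?] := dbl al be.
by split=> //; lra.
Qed.

(** Positive values of [F] occur only inside a compact box; the maximum over that box is positive,
    so it also dominates the nonpositive values outside. *)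
Lemma doubling_max (F : 'rV[R]_N -> 'rV[R]_N -> R -> R) (T rho : R) x0 y0 t0 :
  continuous (fun p : 'rV[R]_N * 'rV[R]_N * R => F p.1.1 p.1.2 p.2) ->
  (forall x y t, 0 <= t <= T -> 0 < F x y t ->
    forall i, `|x 0 i| <= rho /\ `|y 0 i| <= rho) ->
  0 <= t0 <= T -> 0 < F x0 y0 t0 ->
  exists x y t, [/\ 0 <= t <= T, 0 < F x y t
    & forall x' y' t', 0 <= t' <= T -> F x' y' t' <= F x y t].
Proof.
move=> cF bF t0T F0.
pose B := [set z : 'rV[R]_N | forall i, `[- rho, rho]%classic (z ord0 i)].
pose K : set ('rV[R]_N * 'rV[R]_N * R) := (B `*` B) `*` `[0, T].
have cB : compact B.
  have := @rV_compact R N (fun=> `[- rho, rho]%classic).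
  by apply => _; exact: segment_compact.
have cK : compact K.
  by apply: compact_setX; [exact: compact_setX|exact: segment_compact].
have inK x y t : 0 <= t <= T -> 0 < F x y t -> K (x, y, t).
  move=> tT Fpos; split=> /=; last by rewrite in_itv.
  by split=> /= i; have [] := bF _ _ _ tT Fpos i;
    rewrite /= in_itv/= -ler_norml.
have K0 : K !=set0 by exists (x0, y0, t0); exact: inK.
have [[[x y] t]] := compact_EVT_max K0 cK (continuous_subspaceT cF).
rewrite inE => -[/= _]; rewrite in_itv/= => tT Fmax.
have Fpos : 0 < F x y t.
  by apply: (lt_le_trans F0); apply: (Fmax (x0, y0, t0)); rewrite inE; exact: inK.
exists x, y, t; split=> // x' y' t' t'T.
have [F'|/le_trans] := ltP 0 (F x' y' t'); last by apply; exact: ltW.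
by apply: (Fmax (x', y', t')); rewrite inE; exact: inK.
Qed.

End DoublingOfVariables.

(** * The p-condition as monotonicity of a slope of the Hamiltonian *)

Section Hamiltonian.
Context {R : realType}.
Implicit Types (H : R -> R) (Phi : R -> R -> R).

Lemma is_derive_half_pos (f : R -> R) (t l : R) : 0 < t ->
  is_derive_half f t l -> is_derive t 1 f l.
Proof.
move=> t0 fl.
have {}fl : h^-1 *: ((f \o shift t) (h *: 1) - f t) @[h --> 0^'] --> l.
  move=> A /fl; rewrite /= !nbhs_simpl /within/= => Al.
  have tpos : \forall h \near (0 : R)^', 0 <= t + h.
    apply: cvg_within; near=> h.
    have th : - t < h by near: h; apply: lt_nbhsr; rewrite oppr_lt0.
    by lra.
  near=> h; rewrite /= [h *: 1]mulr1 [h + t]addrC; near: h.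
  by apply: filterS2 tpos Al => h th; apply.
apply: DeriveDef; first by apply/cvg_ex; exists l.
exact: (cvg_lim _ fl).
Unshelve. all: by end_near.
Qed.

Lemma smooth_half_derive (f : R -> R) (t : R) : smooth_half f -> 0 < t ->
  is_derive t 1 f (derive1 f t).
Proof.
move=> [g g0 gd] t0.
have dg := is_derive_half_pos (g 0%N) t (g 1%N t) t0 (gd 0%N t (ltW t0)).
have df : is_derive t 1 f (g 1%N t).
  apply: near_eq_is_derive dg.
  by near=> s; apply: g0; apply: ltW; near: s; exact: lt_nbhsr.
by rewrite derive1E derive_val.
Unshelve. all: by end_near.
Qed.

(** The derivative of [f(r^2) / r] is [(2 r^2 f'(r^2) - f(r^2)) / r^2], which is [Theta] at [r^2]
    divided by [r^2]. Integrating the lower bound [(a r^p - B) / r^2] between [r1] and [r2] gives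
    the claim. The factor [th] is the sign that merges the cases [p > 1] and [p < 1]. *)
Lemma slope_growth_eta (f : R -> R) (p a B th r1 r2 : R) :
  smooth_half f -> p != 1 ->
  (forall r : R, 0 < r ->
    a * r `^ (p / 2) - B <= th * (2 * r * derive1 f r - f r)) ->
  0 < r1 -> r1 <= r2 ->
  a / (p - 1) * (r2 `^ (p - 1) - r1 `^ (p - 1)) <=
  th * (f (r2 ^+ 2) / r2 - f (r1 ^+ 2) / r1) + B * (r1^-1 - r2^-1).
Proof.
move=> sf p1 fP r10 r12.
pose w (r : R) := th * (f (r ^+ 2) * r^-1) - a / (p - 1) * r `^ (p - 1)
  - B * r^-1.
pose w1 (r : R) := r ^- 2 * (th * (2 * r ^+ 2 * derive1 f (r ^+ 2) - f (r ^+ 2))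
  - (a * r `^ p - B)).
have dw r : r1 <= r -> is_derive r 1 w (w1 r).
  move=> r1r; have r0 : 0 < r by exact: lt_le_trans r1r.
  have rN0 : r != 0 by rewrite gt_eqF.
  have d1 := smooth_half_derive f _ sf (exprn_gt0 2 r0).
  have d2 : is_derive r 1 (fun r : R => r ^+ 2) (2 * r).
    by apply: is_derive_eq; rewrite /GRing.scale/=; ring.
  have d3 := @is_derive1_comp R f (fun r => r ^+ 2) r _ _ d1 d2.
  have d4 := is_derive1_powR (p - 1) r0.
  have d5 : is_derive r 1 (fun r : R => r^-1) (- r ^- 2).
    have := is_deriveV rN0 (is_derive_id r 1).
    by rewrite [_ *: _]mulr1.
  have pE : r `^ p = r ^+ 2 * r `^ (p - 1 - 1).
    rewrite -[in RHS]powR_mulrn ?ltW// -powRD; last by rewrite rN0 implybT.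
    by congr (_ `^ _); ring.
  rewrite /w /w1; apply: is_derive_eq; rewrite /GRing.scale/= pE.
  have p10 : p - 1 != 0 by rewrite subr_eq0.
  by field; rewrite rN0 p10.
have w1_ge0 r : 0 < r -> 0 <= w1 r.
  move=> r0; rewrite /w1; apply: mulr_ge0.
    by rewrite invr_ge0 exprn_ge0// ltW.
  rewrite subr_ge0.
  have := fP _ (exprn_gt0 2 r0).
  have -> // : (r ^+ 2) `^ (p / 2) = r `^ p.
  by rewrite -powR_mulrn ?ltW// -powRrM mulrC divfK.
have cw : {within `[r1, r2], continuous w}.
  by apply: derivable_within_continuous => h; rewrite in_itv/= => /andP[h1 _];
    case: (dw h h1).
have dw' r : r \in `]r1, r2[ -> is_derive r 1 w (w1 r).
  by rewrite in_itv/= => /andP[/ltW ? _]; exact: dw.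
have [c] := MVT_segment r12 dw' cw.
rewrite in_itv/= => /andP[c1 c2] wE.
have : 0 <= w r2 - w r1.
  by rewrite wE mulr_ge0 ?subr_ge0// w1_ge0//; exact: lt_le_trans c1.
rewrite /w; lra.
Qed.

(** The integrated inequality contains values of [Phi] but no derivatives, so it survives
    [eta -> 0]: the error [b eta^gamma (1/r1 - 1/r2)] vanishes, and uniform convergence on the
    degenerate interval [[r, r]] gives the pointwise limits. *)
Lemma slope_growth H Phi (p a b gamma r1 r2 : R) :
  p != 1 -> basic_assumption H Phi -> p_condition p Phi a b gamma ->
  0 < r1 -> r1 <= r2 ->
  a / (p - 1) * (r2 `^ (p - 1) - r1 `^ (p - 1)) <=
  Num.sg (p - 1) * (H r2 / r2 - H r1 / r1).
Proof.
move=> p1 [_ Phi0 unif] [a0 b0 g0 pgt plt] r10 r12.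
have Phicvg r : 0 <= r -> Phi eta (r ^+ 2) @[eta --> 0^'+] --> H r.
  move=> r0; have := unif r r r0.
  have rr : [set r] `<=` `[r, r] by move=> _ ->; rewrite /= in_itv/= lexx.
  by move=> /(uniform_subset_cvg _ rr); rewrite uniform_set1.
have bcvg : b * eta `^ gamma * (r1^-1 - r2^-1) @[eta --> 0^'+] --> 0.
  have := @cvgMr_tmp _ _ _ _ _ _ (r1^-1 - r2^-1)
    (@cvgMl_tmp _ _ _ _ _ b _ (powR_cvg0 g0)).
  by rewrite mulr0 mul0r; apply.
have r20 : 0 < r2 by exact: lt_le_trans r12.
have lhs : Num.sg (p - 1) *
      (Phi eta (r2 ^+ 2) / r2 - Phi eta (r1 ^+ 2) / r1)
    + b * eta `^ gamma * (r1^-1 - r2^-1) @[eta --> 0^'+]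
    --> Num.sg (p - 1) * (H r2 / r2 - H r1 / r1) + 0.
  have c1 := Phicvg _ (ltW r10); have c2 := Phicvg _ (ltW r20).
  exact: (cvgD (cvgMl_tmp (cvgB (cvgMr_tmp c2) (cvgMr_tmp c1))) bcvg).
rewrite addr0 in lhs.
apply: (cvgr_to_ge lhs).
have [p_gt1|p_le1] := ltP 1 p.
  have s1 : Num.sg (p - 1) = 1 by rewrite gtr0_sg// subr_gt0.
  near=> eta.
  have eta0 : 0 < eta by near: eta; exact: nbhs_right_gt.
  have [_ sPhi _] := Phi0 _ eta0.
  apply: slope_growth_eta => // r r0; rewrite s1 mul1r.
  suff : forall r, 0 < r -> a * r `^ (p / 2) - b * eta `^ gamma <= Theta Phi eta r.
    by apply.
  by near: eta; exact: pgt.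
have p_lt1 : p < 1 by rewrite lt_neqAle p1.
have s1 : Num.sg (p - 1) = -1 by rewrite ltr0_sg// subr_lt0.
near=> eta.
have eta0 : 0 < eta by near: eta; exact: nbhs_right_gt.
have [_ sPhi _] := Phi0 _ eta0.
apply: slope_growth_eta => // r r0; rewrite s1 mulN1r.
suff : forall r, 0 < r -> Theta Phi eta r <= - a * r `^ (p / 2) + b * eta `^ gamma.
  by move=> /(_ _ r0); rewrite /Theta; lra.
by near: eta; exact: plt.
Unshelve. all: by end_near.
Qed.

End Hamiltonian.

(** * Continuity up to the boundary of a half-line or half-space *)

Section Continuity.
Context {R : realType}.

(** With [g] the clamping of time at 0, this turns continuity on the closed half-space into
    continuity everywhere, as the compactness argument for maxima requires. *)
Lemma continuous_within_comp {T U V : topologicalType} (A : set U)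
    (f : U -> V) (g : T -> U) :
  {within A, continuous f} -> continuous g -> (forall t, A (g t)) ->
  continuous (fun t => f (g t)).
Proof.
move=> /subspace_continuousP cf cg Ag t B /(cf (g t) (Ag t)).
rewrite /= !nbhs_simpl /within/= => /cg; rewrite /= !nbhs_simpl.
move=> h; have {}h : nbhs t [set s | A (g s) -> B (f (g s))] := h.
by apply: filterS h => s; apply; exact: Ag.
Qed.

Lemma continuous_pairing {T U V : topologicalType} (f : T -> U) (g : T -> V) :
  continuous f -> continuous g -> continuous (fun t => (f t, g t)).
Proof. by move=> cf cg t; exact: (cvg_pair (cf t) (cg t)). Qed.

Lemma continuous_fst {T U : topologicalType} : continuous (@fst T U).
Proof. by move=> [x y]; exact: cvg_fst. Qed.

Lemma continuous_snd {T U : topologicalType} : continuous (@snd T U).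
Proof. by move=> [x y]; exact: cvg_snd. Qed.

Lemma continuous_composite {T U V : topologicalType} (f : T -> U) (g : U -> V) :
  continuous f -> continuous g -> continuous (fun t => g (f t)).
Proof. by move=> cf cg t; apply: continuous_comp; [exact: cf|exact: cg]. Qed.

Lemma continuous_max0 : continuous (fun t : R => Num.max t 0).
Proof.
move=> t; have c0 : {for t, continuous (cst (0 : R^o))} by exact: cvg_cst.
have c1 : {for t, continuous (@idfun R)} by exact: cvg_id.
exact: (continuous_max c1 c0).
Qed.

(** Only [r] is confined to the segment: the perturbed gradient length [r'] may exceed [B].
    Compactness enters through near coverings, where [d] itself is the parameter tending to 0. *)
Lemma unif_continuous_segment (f : R -> R) (B e : R) :
  {within `[0, +oo[, continuous f} -> 0 < e ->
  exists2 d, 0 < d & forall r r', 0 <= r <= B -> 0 <= r' -> `|r - r'| < d ->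
    `|f r - f r'| < e.
Proof.
move=> cf e0; pose fc (r : R) := f (Num.max r 0).
have cfc : continuous fc.
  apply: continuous_within_comp cf continuous_max0 _ => t.
  by rewrite /= in_itv/= andbT le_max lexx orbT.
have /compact_near_coveringP cK := @segment_compact R 0 B.
have [] := cK R 0^'+ (fun d r => forall r', `|r - r'| < d -> `|fc r - fc r'| < e).
  move=> r rB.
  have e2 : 0 < e / 2 by rewrite divr_gt0.
  have /cvgrPdist_lt/(_ _ e2) [d /= d0 dP] := cfc r.
  have d2 : 0 < d / 2 by rewrite divr_gt0.
  exists ([set s | `|r - s| < d / 2], [set h | h < d / 2]).
    split=> /=; last exact: nbhs_right_lt.
    by exists (d / 2).
  move=> [s h] [/= rs hd] r' sr'.
  have h1 := dP s; have h2 := dP r'.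
  have {}h1 : `|fc r - fc s| < e / 2 by apply: h1; rewrite /=; lra.
  have {}h2 : `|fc r - fc r'| < e / 2.
    apply: h2; rewrite /= (_ : r - r' = (r - s) + (s - r')); last by ring.
    by apply: le_lt_trans (ler_normD _ _) _; lra.
  rewrite (_ : fc s - fc r' = (fc r - fc r') - (fc r - fc s)); last by ring.
  by apply: le_lt_trans (ler_normB _ _) _; lra.
move=> d /= d0 dP; exists (d / 2); first by rewrite divr_gt0.
move=> r r' /andP[r0 rB] r'0 rr'.
have := dP (d / 2); rewrite /= sub0r normrN gtr0_norm ?divr_gt0//.
have d2 : d / 2 < d by lra.
move=> /(_ d2 isT r); rewrite /= in_itv/= r0 rB => /(_ isT r' rr').
by rewrite /fc !max_l.
Qed.

End Continuity.

(** * The properties of solutions used in the comparison arguments *)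

Section RegularSolutions.
Context {R : realType} {N : nat}.
Implicit Types (H : R -> R) (v w : 'rV[R]_N -> R -> R).

Definition regular_solution H (eps : R) v :=
  [/\ continuous (fun p : 'rV[R]_N * R => v p.1 (Num.max p.2 0)),
      forall i x (t : R), 0 <= t ->
        is_derive x (delta_mx 0 i) (v ^~ t) (partial i (v ^~ t) x),
      forall i x (t : R), 0 <= t ->
        is_derive x (delta_mx 0 i) (partial i (v ^~ t))
          (partial i (partial i (v ^~ t)) x)
    & forall x (t : R), 0 < t -> is_derive t 1 (v x)
        (eps * laplacian (v ^~ t) x - H (enorm (grad (v ^~ t) x)))].

Lemma solution_regular H eps phi v :
  solution H eps phi v -> regular_solution H eps v.
Proof.
move=> [[cv dv ddv [vt dvt _]] pde _ _ _]; split.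
- pose clamp (p : 'rV[R]_N * R) := (p.1, Num.max p.2 0).
  apply: (continuous_within_comp _ _ clamp cv); last first.
    by move=> p /=; rewrite le_max lexx orbT.
  apply: continuous_pairing; first exact: continuous_fst.
  exact: continuous_composite continuous_snd continuous_max0.
- by move=> i x t t0; apply: derivableP; have [+ _] := dv i; exact.
- by move=> i x t t0; apply: derivableP; have [+ _] := ddv i i; exact.
- move=> x t t0.
  have d := is_derive_half_pos _ _ _ t0 (dvt x t (ltW t0)).
  have -> : eps * laplacian (v ^~ t) x - H (enorm (grad (v ^~ t) x)) = vt x t.
    by have := pde x t t0; rewrite derive1E derive_val; lra.
  exact: d.
Qed.

Lemma partialN (f : 'rV[R]_N -> R) i x : has_partial i f x ->
  partial i (fun y => - f y) x = - partial i f x.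
Proof. by move=> df; rewrite /partial (_ : (fun y => _) = - f)// deriveN. Qed.

(** This symmetry reduces lower bounds on the time derivative to upper bounds. *)
Lemma regular_solutionN H eps v : regular_solution H eps v ->
  regular_solution (fun r => - H r) eps (fun x t => - v x t).
Proof.
move=> [cv dv ddv pde].
have pN i t : 0 <= t ->
    partial i (fun y => - v y t) = (fun y => - partial i (v ^~ t) y).
  by move=> t0; apply/funext => x; apply: partialN; case: (dv i x t t0).
split.
- by move=> p; apply: cvgN; exact: cv.
- by move=> i x t t0; rewrite pN//; have := dv i x t t0 => ?; exact: is_deriveN.
- move=> i x t t0; rewrite pN// partialN; last by case: (ddv i x t t0).
  by have := ddv i x t t0 => ?; exact: is_deriveN.
- move=> x t t0; have dvt := pde x t t0.
  have -> : laplacian (fun y => - v y t) x = - laplacian (v ^~ t) x.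
    rewrite /laplacian -sumrN; apply: eq_bigr => i _.
    by rewrite pN ?ltW// partialN//; case: (ddv i x t (ltW t0)).
  have -> : grad (fun y => - v y t) x = - grad (v ^~ t) x.
    by apply/rowP => i; rewrite !mxE pN ?ltW.
  rewrite enormN mulrN -opprD; exact: is_deriveN.
Qed.

End RegularSolutions.

Section DirectionalChainRule.
Context {R : realType} {V : normedModType R}.

(** Restriction to the line through [x] along [v] reduces this to the one-variable chain rule, so
    [f] only has to be differentiable in that one direction. *)
Lemma is_derive_chain (U : R -> R) (f : V -> R) (x v : V) (m l : R) :
  is_derive (f x) 1 U m -> is_derive x v f l ->
  is_derive x v (fun y => U (f y)) (m * l).
Proof.
move=> dU df; have x0 : x = x + (0 : R) *: v by rewrite scale0r addr0.
have df0 : is_derive (x + (0 : R) *: v) v f l by rewrite -x0.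
have [+ _] := is_derive_line f x v 0 l => /(_ df0) d1.
have [_ +] := is_derive_line (fun y => U (f y)) x v 0 (m * l).
rewrite -x0; apply.
have dU0 : is_derive (f (x + (0 : R) *: v)) 1 U m by rewrite -x0.
exact: (@is_derive1_comp R U (fun k => f (x + k *: v)) 0 _ _ dU0 d1).
Qed.

End DirectionalChainRule.

Lemma exists_lt3 {R : realType} (a b c : R) : 0 < a -> 0 < b -> 0 < c ->
  exists s : R, [/\ 0 < s, s < a, s < b & s < c].
Proof.
move=> a0 b0 c0; near (0 : R)^'+ => s; exists s; split; near: s;
  [exact: nbhs_right_gt|exact: nbhs_right_lt..].
Unshelve. all: by end_near. Qed.

(** * The decaying Lipschitz constant used as a barrier *)

Section PowerDecay.
Context {R : realType}.
Variables (k c tau : R).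
Hypotheses (k0 : 0 < k) (c0 : 0 < c) (tau0 : 0 < tau).

(* The solution of L' = - c L^(k + 1) with L(- tau) = +oo. *)
Definition decay (t : R) := (k * c * (t + tau)) `^ (- k^-1).

Lemma decay_base t : 0 <= t -> 0 < k * c * (t + tau).
Proof. by move=> t0; rewrite !mulr_gt0// ltr_wpDl. Qed.

Lemma decay_gt0 t : 0 <= t -> 0 < decay t.
Proof. by move=> t0; rewrite powR_gt0// decay_base. Qed.

Lemma decay_le s t : 0 <= s -> s <= t -> decay t <= decay s.
Proof.
move=> s0 st; have t0 := le_trans s0 st.
rewrite /decay !powRN lef_pV2 ?posrE ?powR_gt0 ?decay_base//.
apply: ge0_ler_powR; first by rewrite invr_ge0 ltW.
- by rewrite nnegrE ltW// decay_base.
- by rewrite nnegrE ltW// decay_base.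
- by apply: ler_wpM2l; [rewrite mulr_ge0// ltW|rewrite lerD2r].
Qed.

Lemma is_derive_decay (t : R) : 0 <= t ->
  is_derive t 1 decay (- c * (decay t `^ k * decay t)).
Proof.
move=> t0; have b0 := decay_base t t0.
have d1 : is_derive t 1 (fun t : R => k * c * (t + tau)) (k * c).
  by apply: is_derive_eq; rewrite /GRing.scale/=; ring.
have d2 := is_derive1_powR (- k^-1) b0.
have d3 := @is_derive1_comp R (fun x : R => x `^ (- k^-1)) _ t _ _ d2 d1.
apply: (is_derive_eq d3).
have -> : decay t `^ k = (k * c * (t + tau))^-1.
  by rewrite -powRrM mulNr mulVf ?gt_eqF// powR_inv1 ?ltW.
rewrite /decay powRD ?(gt_eqF b0) ?implybT// powR_inv1 ?ltW//.
by field; rewrite !gt_eqF ?ltr_wpDl.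
Qed.

Lemma decay_continuous : continuous (fun t : R => decay (Num.max t 0)).
Proof.
have cd : {within `[0, +oo[, continuous decay}.
  by apply: derivable_within_continuous => t; rewrite in_itv/= andbT => t0;
    case: (is_derive_decay t t0).
apply: continuous_within_comp cd continuous_max0 _ => t.
by rewrite /= in_itv/= andbT le_max lexx orbT.
Qed.

End PowerDecay.

(** * Lipschitz bound for a transform of the solution *)

Section TransformedLipschitz.
Context {R : realType} {N : nat}.
Variables (H U g dg : R -> R) (eps M k c gmin gmax D Lip : R).
Variable v : 'rV[R]_N -> R -> R.
Hypotheses (eps0 : 0 < eps) (k0 : 0 < k) (c0 : 0 < c) (gmin0 : 0 < gmin).
Hypothesis cH : {within `[0, +oo[, continuous H}.
Hypothesis solv : regular_solution H eps v.
Hypothesis v0M : forall x t, 0 <= t -> 0 <= v x t <= M.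
Hypothesis vLip : forall x y, v x 0 - v y 0 <= Lip * enorm (x - y).
Hypothesis dU : forall s : R, 0 <= s <= M -> is_derive s 1 U (g s)^-1.
Hypothesis dgP : forall s : R, 0 <= s <= M -> is_derive s 1 g (dg s).
Hypothesis gP : forall s : R, 0 <= s <= M -> gmin <= g s <= gmax.
Hypothesis dgD : forall s : R, 0 <= s <= M -> `|dg s| <= D.
(** For [u = U(v)], the right-hand side is the rate at which the first-order terms of the equation
    for [u] decrease [u(x) - u(y)] when both gradients of [u] have length [L] and [v] takes the
    values [s1], [s2]. The left-hand side, a multiple of [u(x) - u(y)], is what drives the decay of
    the Lipschitz constant. *)
Hypothesis structure : forall s1 s2 L, 0 <= s2 -> s2 <= s1 -> s1 <= M -> 0 < L ->
  c * L `^ k * (U s1 - U s2) <=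
  H (g s1 * L) / g s1 - H (g s2 * L) / g s2 + eps * (dg s2 - dg s1) * L ^+ 2.

Let g_gt0 s : 0 <= s <= M -> 0 < g s.
Proof. by move=> /gP/andP[+ _]; exact: lt_le_trans. Qed.

Lemma transform_mvt s1 s2 : 0 <= s2 -> s2 <= s1 -> s1 <= M ->
  exists2 s, 0 <= s <= M & U s1 - U s2 = (g s)^-1 * (s1 - s2).
Proof.
move=> s20 s21 s1M.
have inM s : s2 <= s -> s <= s1 -> 0 <= s <= M.
  by move=> ? ?; apply/andP; split; lra.
have cU : {within `[s2, s1], continuous U}.
  apply: derivable_within_continuous => s; rewrite in_itv/= => /andP[h1 h2].
  by case: (dU s (inM s h1 h2)).
have dU' s : s \in `]s2, s1[ -> is_derive s 1 U (g s)^-1.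
  by rewrite in_itv/= => /andP[/ltW h1 /ltW h2]; apply: dU; exact: inM.
have [s] := MVT_segment s21 dU' cU.
by rewrite in_itv/= => /andP[h1 h2] ->; exists s => //; exact: inM.
Qed.

Lemma transform_incr s1 s2 : 0 <= s2 -> s2 <= s1 -> s1 <= M ->
  0 <= U s1 - U s2 <= gmin^-1 * (s1 - s2).
Proof.
move=> s20 s21 s1M; have [s sM ->] := transform_mvt s1 s2 s20 s21 s1M.
have /andP[gs _] := gP s sM.
have s12 : 0 <= s1 - s2 by lra.
rewrite mulr_ge0//=; last by rewrite invr_ge0 ltW// g_gt0.
by rewrite ler_wpM2r// lef_pV2 ?posrE ?g_gt0.
Qed.

Lemma transform_expand s1 s2 : 0 <= s2 -> s2 <= s1 -> s1 <= M ->
  s1 - s2 <= gmax * (U s1 - U s2).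
Proof.
move=> s20 s21 s1M; have [s sM ->] := transform_mvt s1 s2 s20 s21 s1M.
have /andP[_ gs] := gP s sM.
have s12 : 0 <= s1 - s2 by lra.
by rewrite mulrA ler_peMl// ler_pdivlMr ?g_gt0// mul1r.
Qed.

Lemma transform_osc s1 s2 : 0 <= s1 <= M -> 0 <= s2 <= M ->
  U s1 - U s2 <= U M - U 0.
Proof.
move=> /andP[s10 s1M] /andP[s20 s2M].
have /andP[h1 _] := transform_incr M s1 s10 s1M (lexx _).
have /andP[h2 _] := transform_incr s2 0 (lexx _) s20 s2M.
by lra.
Qed.

Lemma transform_partial t i x : 0 <= t ->
  is_derive x (delta_mx 0 i) (fun y => U (v y t))
    (partial i (v ^~ t) x / g (v x t)).
Proof.
case: solv => _ dv _ _ t0; rewrite mulrC.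
by apply: is_derive_chain; [exact/dU/v0M|exact: dv].
Qed.

Lemma transform_partial2 t i x : 0 <= t ->
  is_derive x (delta_mx 0 i) (fun y => partial i (v ^~ t) y / g (v y t))
    (partial i (partial i (v ^~ t)) x / g (v x t)
     - dg (v x t) * (partial i (v ^~ t) x / g (v x t)) ^+ 2).
Proof.
case: solv => _ dv ddv _ t0.
have gN0 : g (v x t) != 0 by rewrite gt_eqF// g_gt0// v0M.
have d1 := is_deriveV gN0 (dgP _ (v0M x t t0)).
have d2 := is_derive_chain _ (v ^~ t) x (delta_mx 0 i) _ _ d1 (dv i x t t0).
have d3 := is_deriveM (ddv i x t t0) d2.
apply: (is_derive_eq d3); rewrite /GRing.scale/=.
by field.
Qed.

Lemma transform_time x (t : R) : 0 < t ->
  is_derive t 1 (fun s => U (v x s))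
    ((eps * laplacian (v ^~ t) x - H (enorm (grad (v ^~ t) x))) / g (v x t)).
Proof.
case: solv => _ _ _ dvt t0; rewrite mulrC.
by apply: is_derive_chain; [exact/dU/v0M/ltW|exact: dvt].
Qed.

Lemma transform_continuous :
  continuous (fun p : 'rV[R]_N * R => U (v p.1 (Num.max p.2 0))).
Proof.
move=> p; case: solv => cv _ _ _.
apply: (@continuous_comp _ _ _ (fun p : 'rV[R]_N * R => v p.1 (Num.max p.2 0)) U).
  exact: cv.
apply/differentiable_continuous/derivable1_diffP.
by have [] := dU _ (v0M p.1 (Num.max p.2 0) _); rewrite ?le_max ?lexx ?orbT.
Qed.

(** Pure arithmetic behind the maximum test. Here [lx], [ly] are the Laplacians of [v], [i1], [i2]
    the inverses of [g], [d1], [d2] the values of [g'], and [r], [L] the gradient lengths of [u] at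
    the two points; [h1] and [h1L] are [H] at [g r] and at [g L] for the first point. *)
Lemma scaled_defect_algebra (lx ly i1 i2 d1 d2 r L h1 h1L h2 cLk z du n sg kap : R) :
  0 <= (eps * lx - h1) * i1 - (eps * ly - h2) * i2 - - cLk * z - kap ->
  lx * i1 - d1 * r ^+ 2 - (ly * i2 - d2 * L ^+ 2) <= 2 * n * sg ->
  cLk * z <= du ->
  du <= h1L * i1 - h2 * i2 + eps * (d2 - d1) * L ^+ 2 ->
  kap <= 2 * eps * n * sg + eps * d1 * (r ^+ 2 - L ^+ 2) + (h1L - h1) * i1.
Proof.
move=> h1' h2' h3 h4.
have {}h2' : eps * (lx * i1 - d1 * r ^+ 2 - (ly * i2 - d2 * L ^+ 2)) <=
    eps * (2 * n * sg) by rewrite ler_wpM2l// ltW.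
lra.
Qed.

(* [Lam t' * |z'|] is replaced by a quadratic in [z'] touching it from above at
   [x - y], so that only quadratics are differentiated. *)
Lemma transform_test (Lam : R -> R) (x y : 'rV[R]_N) (t sg kap : R) :
  0 < t -> 0 < sg -> 0 < Lam t ->
  is_derive t 1 Lam (- c * (Lam t `^ k * Lam t)) ->
  0 < enorm (x - y) ->
  Lam t * enorm (x - y) <= U (v x t) - U (v y t) ->
  (forall x' y' t', 0 <= t' <= t ->
    U (v x' t') - U (v y' t') - Lam t' * enorm (x' - y') - sg * enorm x' ^+ 2
      - kap * t' <=
    U (v x t) - U (v y t) - Lam t * enorm (x - y) - sg * enorm x ^+ 2
      - kap * t) ->
  exists r, [/\ `|r - Lam t| <= 2 * sg * enorm x, 0 <= r &
    kap <= 2 * eps * N%:R * sg + eps * dg (v x t) * (r ^+ 2 - Lam t ^+ 2)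
      + (H (g (v x t) * Lam t) - H (g (v x t) * r)) / g (v x t)].
Proof.
move=> t0 sg0 L0 dLam z0 Lu Fmax.
have t0' := ltW t0.
have zN0 : enorm (x - y) != 0 by rewrite gt_eqF.
have [A AE] : exists A, A = Lam t / (2 * enorm (x - y)) by eexists.
have A20 : 0 < 2 * A by rewrite AE mulr_gt0// divr_gt0// mulr_gt0.
have xM := v0M x t t0'; have yM := v0M y t t0'.
have g1 := g_gt0 _ xM; have g2 := g_gt0 _ yM.
have quad : forall x' y' : 'rV[R]_N,
    U (v x' t) - U (v y' t) - A * enorm (x' - y') ^+ 2 - sg * enorm x' ^+ 2 <=
    U (v x t) - U (v y t) - A * enorm (x - y) ^+ 2 - sg * enorm x ^+ 2.
  move=> x' y'; have := Fmax x' y' t; rewrite t0' lexx => /(_ isT).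
  have -> : A * enorm (x - y) ^+ 2 = Lam t * enorm (x - y) / 2.
    by rewrite AE; field.
  have : Lam t * enorm (x' - y') <=
      A * enorm (x' - y') ^+ 2 + Lam t * enorm (x - y) / 2.
    have -> : A * enorm (x' - y') ^+ 2 + Lam t * enorm (x - y) / 2 =
        Lam t * enorm (x' - y') + A * (enorm (x' - y') - enorm (x - y)) ^+ 2.
      by rewrite AE; field.
    by rewrite lerDl mulr_ge0 ?sqr_ge0// -(pmulr_rge0 _ (ltr0n R 2)) ltW.
  by lra.
have [q qE] : exists q, q = (2 * A) *: (x - y) by eexists.
have qL : enorm q = Lam t by rewrite qE enormZ gtr0_norm// AE; field.
have test i := doubling_test (fun y => U (v y t)) _ (fun y => U (v y t)) _ _ _
  i x y 1 1 A sg (fun z => transform_partial t i z t0')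
  (transform_partial2 t i x t0')
  (fun z => transform_partial t i z t0') (transform_partial2 t i y t0') quad.
have [r rE] : exists r, r = enorm (q + (2 * sg) *: x) by eexists.
have gx : grad (v ^~ t) x = g (v x t) *: (q + (2 * sg) *: x).
  apply/rowP => i; rewrite qE !mxE; have [+ _ _] := test i; rewrite !mxE => <-.
  by rewrite mulrC divfK// gt_eqF.
have gy : grad (v ^~ t) y = g (v y t) *: q.
  apply/rowP => i; rewrite qE !mxE; have [_ + _] := test i; rewrite !mxE => <-.
  by rewrite mulrC divfK// gt_eqF.
have nx : enorm (grad (v ^~ t) x) = g (v x t) * r.
  by rewrite gx enormZ gtr0_norm// rE.
have ny : enorm (grad (v ^~ t) y) = g (v y t) * Lam t.
  by rewrite gy enormZ gtr0_norm// qL.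
have sumsq w l : 0 < g (v w t) -> enorm (grad (v ^~ t) w) = g (v w t) * l ->
    \sum_i (partial i (v ^~ t) w / g (v w t)) ^+ 2 = l ^+ 2.
  move=> gw nw; have -> : l = enorm (grad (v ^~ t) w) / g (v w t).
    by rewrite nw mulrC mulKf// gt_eqF.
  rewrite expr_div_n sqr_enorm mulr_suml.
  by apply: eq_bigr => i _; rewrite expr_div_n !mxE.
have lap : laplacian (v ^~ t) x / g (v x t) - dg (v x t) * r ^+ 2
    - (laplacian (v ^~ t) y / g (v y t) - dg (v y t) * Lam t ^+ 2) <=
    2 * N%:R * sg.
  rewrite -(sumsq x r g1 nx) -(sumsq y (Lam t) g2 ny) /laplacian.
  rewrite !mulr_suml !mulr_sumr -!sumrB.
  have -> : 2 * N%:R * sg = \sum_(i < N) (2 * sg).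
    by rewrite sumr_const card_ord -[RHS]mulr_natr mulrAC.
  apply: ler_sum => i _; have [_ _] := test i.
  by rewrite !expr1n !mul1r subrr expr0n mulr0 add0r mulr1.
have dF : is_derive t 1 (fun s => U (v x s) - U (v y s) - Lam s * enorm (x - y)
      - sg * enorm x ^+ 2 - kap * s)
    ((eps * laplacian (v ^~ t) x - H (enorm (grad (v ^~ t) x))) / g (v x t)
     - (eps * laplacian (v ^~ t) y - H (enorm (grad (v ^~ t) y))) / g (v y t)
     - (- c * (Lam t `^ k * Lam t)) * enorm (x - y) - kap).
  have d1 := transform_time x t t0; have d2 := transform_time y t t0.
  apply: is_derive_eq; rewrite /GRing.scale/= !(mulr0, subr0, addr0, add0r).
  by rewrite mulr1 [_ * enorm _]mulrC.
have := derive_ge0_left _ t _ t0 dF (fun s st => Fmax x y s st).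
rewrite nx ny => dt.
exists r; split.
- have sg2 : 0 < 2 * sg by rewrite mulr_gt0.
  have := enorm_dist q ((2 * sg) *: x).
  by rewrite -rE qL enormZ [`|2 * sg|]gtr0_norm.
- by rewrite rE enorm_ge0.
(* The structure condition needs ordered values; the order holds because [U(v x t) - U(v y t)] is
   positive and [U] is nondecreasing. *)
have vyx : v y t <= v x t.
  rewrite leNgt; apply/negP => vxy.
  move: xM yM => /andP[x0 _] /andP[_ y1].
  have /andP[+ _] := transform_incr _ _ x0 (ltW vxy) y1.
  have Lz := mulr_gt0 L0 z0.
  by rewrite subr_ge0 leNgt -subr_gt0 (lt_le_trans Lz).
move: (xM) (yM) => /andP[_ x1] /andP[y0 _].
apply: (scaled_defect_algebra _ _ _ _ _ _ _ _ _ _ _ _ _ _ _ _ _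
  _ lap _ (structure _ _ _ y0 vyx x1 L0)).
  by move: dt; rewrite [- c * _]mulNr; apply.
rewrite -!mulrA; apply: ler_wpM2l; first exact: ltW.
by rewrite ler_wpM2l// powR_ge0.
Qed.

Lemma transform_initial (Lp : R) x y : 0 <= Lp -> Lip / gmin <= Lp ->
  U (v x 0) - U (v y 0) <= Lp * enorm (x - y).
Proof.
move=> Lp0 LipLp; have /andP[x0 x1] := v0M x 0 (lexx _).
have /andP[y0 y1] := v0M y 0 (lexx _).
have [yx|/ltW xy] := leP (v y 0) (v x 0); last first.
  have /andP[+ _] := transform_incr _ _ x0 xy y1.
  rewrite -opprB oppr_ge0 => /le_trans; apply.
  by rewrite mulr_ge0 ?enorm_ge0.
have /andP[_] := transform_incr _ _ y0 yx x1; move/le_trans; apply.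
apply: le_trans (ler_wpM2r (enorm_ge0 _) LipLp); rewrite mulrAC mulrC.
by rewrite ler_wpM2r ?vLip// invr_ge0 ltW.
Qed.

(** The penalty makes the gradient length at [x] equal to some [r] near [L] instead of [L]. The cost
    of this discrepancy is bounded uniformly in the position of the maximum, which is unknown when
    the penalty is chosen. *)
Lemma transform_perturbation (Lp kap : R) : 0 < Lp -> 0 < kap ->
  0 < gmax -> 0 <= D ->
  exists2 rho, 0 < rho & forall L r g1 d1, 0 <= L <= Lp -> 0 <= r ->
    `|r - L| < rho -> gmin <= g1 <= gmax -> `|d1| <= D ->
    eps * d1 * (r ^+ 2 - L ^+ 2) + (H (g1 * L) - H (g1 * r)) / g1 <= kap / 2.
Proof.
move=> Lp0 kap0 gmax0 D0.
have e0 : 0 < kap * gmin / 4 by rewrite !mulr_gt0.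
have [d d0 dP] := unif_continuous_segment H (gmax * Lp) _ cH e0.
have C0 : 0 < 4 * eps * (D + 1) * (2 * Lp + 1).
  by rewrite !mulr_gt0 ?ltr_wpDl// ?mulr_ge0// ltW.
(* The bound 1 gives [r + L <= 2 Lp + 1], the bound [d / gmax] keeps [g1 |r - L|] below the modulus
   of continuity of [H], and the last one makes the quadratic term at most [kap / 4]. *)
have [rho [rho0 rho1 rhod rhoC]] := exists_lt3 1 (d / gmax)
  (kap / (4 * eps * (D + 1) * (2 * Lp + 1))) ltr01 (divr_gt0 d0 gmax0)
  (divr_gt0 kap0 C0).
exists rho => // L r g1 d1 /andP[L0 L1] r0 rL /andP[gg1 gg2] dD.
have g10 : 0 < g1 by exact: lt_le_trans gg1.
have -> : kap / 2 = kap / 4 + kap / 4 by field.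
apply: lerD.
  apply: le_trans (ler_norm _) _.
  rewrite subr_sqr !normrM (gtr0_norm eps0) (ger0_norm (addr_ge0 r0 L0)).
  have rL2 : r + L <= 2 * Lp + 1.
    by move: rL; rewrite ltr_norml => /andP[_ rL']; lra.
  have dD1 : `|d1| <= D + 1 by lra.
  rewrite ltr_pdivlMr// in rhoC.
  apply: (@le_trans _ _ (eps * (D + 1) * (rho * (2 * Lp + 1)))); last by lra.
  apply: ler_pM; rewrite ?mulr_ge0 ?(ltW eps0) ?normr_ge0 ?addr_ge0//.
    by rewrite ler_wpM2l// ltW.
  by apply: ler_pM; rewrite ?addr_ge0// ltW.
apply: le_trans (ler_norm _) _.
rewrite normrM normfV (gtr0_norm g10) ler_pdivrMr//.
have dH : `|H (g1 * L) - H (g1 * r)| < kap * gmin / 4.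
  apply: dP.
  - rewrite mulr_ge0 ?(ltW g10)//=.
    by apply: ler_pM; rewrite ?(ltW g10).
  - by rewrite mulr_ge0 ?(ltW g10).
  - rewrite -mulrBr normrM (gtr0_norm g10) distrC.
    rewrite ltr_pdivlMr// mulrC in rhod.
    apply: le_lt_trans rhod; apply: ler_pM => //; first exact: ltW.
    exact: ltW.
apply: le_trans (ltW dH) _; rewrite mulrAC.
by apply: ler_wpM2l => //; rewrite divr_ge0 ?(ltW kap0).
Qed.

Lemma transformed_lipschitz x y (t : R) : 0 < t ->
  U (v x t) - U (v y t) <= (k * c * t) `^ (- k^-1) * enorm (x - y).
Proof.
move=> t0; rewrite leNgt; apply/negP => viol.
have M0 : 0 <= M by have /andP[/le_trans h /h] := v0M x 0 (lexx _).
have OM : 0 <= (0 : R) <= M by rewrite lexx M0.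
have gmax0 : 0 < gmax.
  by have /andP[/(lt_le_trans gmin0)/lt_le_trans h /h] := gP 0 OM.
have D0 : 0 <= D by apply: le_trans (normr_ge0 _) (dgD 0 OM).
have [Lp [Lp0 LipLp]] : exists Lp, 0 < Lp /\ Lip / gmin <= Lp.
  exists (`|Lip / gmin| + 1); split; first by rewrite ltr_wpDl.
  by apply: le_trans (ler_norm _) _; rewrite lerDl.
have kc0 : 0 < k * c by rewrite mulr_gt0.
(* The barrier starts at the finite value [Lp], which dominates the initial Lipschitz constant of
   [U(v)]. Dropping [tau] afterwards only enlarges the bound, so the result does not depend on the
   initial slope. *)
have [tau [tau0 tauE]] : exists tau, 0 < tau /\ decay k c tau 0 = Lp.
  exists (Lp `^ (- k) / (k * c)); split; first by rewrite divr_gt0 ?powR_gt0.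
  rewrite /decay add0r mulrC divfK ?gt_eqF//.
  by rewrite -powRrM mulrNN mulfV ?gt_eqF// powRr1// ltW.
have Lam0 s : 0 <= s -> 0 < decay k c tau s by exact: decay_gt0.
have LamLp s : 0 <= s -> decay k c tau s <= Lp.
  by move=> s0; rewrite -tauE; exact: decay_le.
have Lamt : decay k c tau t <= (k * c * t) `^ (- k^-1).
  rewrite /decay !powRN lef_pV2 ?posrE ?powR_gt0 ?mulr_gt0 ?addr_gt0//.
  apply: ge0_ler_powR; first by rewrite invr_ge0 ltW.
  - by rewrite nnegrE ltW// mulr_gt0.
  - by rewrite nnegrE ltW// mulr_gt0// addr_gt0.
  - by rewrite ler_pM2l// lerDl ltW.
have [gap gapE] : exists gap, gap =
    U (v x t) - U (v y t) - decay k c tau t * enorm (x - y) by eexists.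
have gap0 : 0 < gap.
  rewrite gapE subr_gt0; apply: le_lt_trans viol.
  by rewrite ler_wpM2r ?enorm_ge0.
have [kap kapE] : exists kap, kap = gap / (4 * t) by eexists.
have kap0 : 0 < kap by rewrite kapE divr_gt0// mulr_gt0.
have kapt : kap * t = gap / 4 by rewrite kapE; field; rewrite gt_eqF.
have [rho rho0 rhoP] := transform_perturbation Lp kap Lp0 kap0 gmax0 D0.
have [K [K0 KP]] : exists K, 0 < K /\ forall s1 s2, 0 <= s1 <= M ->
    0 <= s2 <= M -> U s1 - U s2 <= K.
  exists (`|U M - U 0| + 1); split; first by rewrite ltr_wpDl.
  move=> s1 s2 s1M s2M; apply: le_trans (transform_osc _ _ s1M s2M) _.
  by apply: le_trans (ler_norm _) _; rewrite lerDl.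
have X0 : 0 < 4 * (enorm x ^+ 2 + 1) by rewrite mulr_gt0// ltr_wpDl ?sqr_ge0.
have N0 : 0 < 8 * eps * (N%:R + 1) by rewrite !mulr_gt0// ltr_wpDl.
(* Together with [kap t = gap / 4], the first condition leaves [F] positive at the given point; the
   second bounds the Laplacian of the penalty. The third controls the gradient shift: from
   [sg |x1|^2 <= K] follows [(sg |x1|)^2 <= sg K < (rho / 2)^2], although [|x1|] itself may be
   large. *)
have [sg [sg0 sgX sgN sgK]] := exists_lt3 (gap / (4 * (enorm x ^+ 2 + 1)))
  (kap / (8 * eps * (N%:R + 1))) ((rho / 2) ^+ 2 / K)
  (divr_gt0 gap0 X0) (divr_gt0 kap0 N0)
  (divr_gt0 (exprn_gt0 2 (divr_gt0 rho0 (ltr0n R 2))) K0).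
rewrite ltr_pdivlMr// in sgX; rewrite ltr_pdivlMr// in sgN.
rewrite ltr_pdivlMr// in sgK.
pose F (x y : 'rV[R]_N) (t : R) := U (v x (Num.max t 0)) - U (v y (Num.max t 0))
  - decay k c tau (Num.max t 0) * enorm (x - y) - sg * enorm x ^+ 2
  - kap * Num.max t 0.
have FE x' y' s : 0 <= s -> F x' y' s = U (v x' s) - U (v y' s)
    - decay k c tau s * enorm (x' - y') - sg * enorm x' ^+ 2 - kap * s.
  by move=> s0; rewrite /F max_l.
have cF : continuous (fun p : 'rV[R]_N * 'rV[R]_N * R => F p.1.1 p.1.2 p.2).
  have c11 : continuous (fun p : 'rV[R]_N * 'rV[R]_N * R => p.1.1).
    exact: continuous_composite continuous_fst continuous_fst.
  have c12 : continuous (fun p : 'rV[R]_N * 'rV[R]_N * R => p.1.2).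
    exact: continuous_composite continuous_fst continuous_snd.
  have c2 : continuous (fun p : 'rV[R]_N * 'rV[R]_N * R => p.2).
    exact: continuous_snd.
  have cU1 := continuous_composite _ _ (continuous_pairing _ _ c11 c2)
    transform_continuous.
  have cU2 := continuous_composite _ _ (continuous_pairing _ _ c12 c2)
    transform_continuous.
  have cL : continuous (fun p : 'rV[R]_N * 'rV[R]_N * R =>
      decay k c tau (Num.max p.2 0)).
    exact: continuous_composite c2 (decay_continuous k c tau k0 c0 tau0).
  have cz : continuous (fun p : 'rV[R]_N * 'rV[R]_N * R =>
      enorm (p.1.1 - p.1.2)).
    by apply: continuous_enorm => p; exact: (cvgB (c11 p) (c12 p)).
  have cx := continuous_enorm _ _ c11.
  have cm := continuous_composite _ _ c2 continuous_max0.
  move=> p; apply: cvgB; last exact: (cvgMl_tmp (cm p)).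
  apply: cvgB; last exact: (cvgMl_tmp (cvgM (cx p) (cx p))).
  apply: cvgB; last exact: (cvgM (cL p) (cz p)).
  exact: (cvgB (cU1 p) (cU2 p)).
have inM z s : 0 <= s -> 0 <= v z s <= M by exact: v0M.
have Fpos : 0 < F x y t.
  rewrite FE ?ltW// kapt -gapE; nra.
have sgx x' y' s : 0 <= s -> 0 < F x' y' s -> sg * enorm x' ^+ 2 <= K /\
    decay k c tau s * enorm (x' - y') <= U (v x' s) - U (v y' s).
  move=> s0; rewrite FE// => F0.
  have h1 := KP _ _ (inM x' s s0) (inM y' s s0).
  have h2 : 0 <= decay k c tau s * enorm (x' - y').
    by rewrite mulr_ge0 ?enorm_ge0// ltW// Lam0.
  have h3 : 0 <= sg * enorm x' ^+ 2 by rewrite mulr_ge0 ?sqr_ge0// ltW.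
  have h4 : 0 <= kap * s by rewrite mulr_ge0// ltW.
  by split; lra.
have bF x' y' s : 0 <= s <= t -> 0 < F x' y' s ->
    forall i, `|x' 0 i| <= K / sg + 1 + K / decay k c tau t /\
      `|y' 0 i| <= K / sg + 1 + K / decay k c tau t.
  move=> /andP[s0 st] F0; have [h1 h2] := sgx x' y' s s0 F0.
  have Lt0 := Lam0 t (ltW t0).
  have hx : enorm x' <= K / sg + 1.
    have : enorm x' ^+ 2 <= K / sg by rewrite ler_pdivlMr// mulrC.
    have := sqr_ge0 (enorm x' - 1); nra.
  have hz : enorm (x' - y') <= K / decay k c tau t.
    rewrite ler_pdivlMr// mulrC.
    apply: le_trans (KP _ _ (inM x' s s0) (inM y' s s0)).
    apply: le_trans h2; rewrite ler_wpM2r ?enorm_ge0//.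
    exact: decay_le.
  have hy : enorm y' <= enorm x' + enorm (x' - y').
    by have := enormD x' (- (x' - y')); rewrite enormN opprB addrC subrK.
  have hz0 := enorm_ge0 (x' - y').
  move=> i; have := coord_le_enorm x' i; have := coord_le_enorm y' i.
  by split; lra.
have tt : 0 <= t <= t by rewrite ltW/=.
have [x1 [y1 [s [/andP[s0 st] Fs Fmax]]]] := doubling_max F t _ x y t cF bF tt Fpos.
have [sgx1 Lu] := sgx x1 y1 s s0 Fs.
(* At time 0 the barrier has slope [Lp], so [F] cannot be positive there; likewise it cannot be
   positive where [x1 = y1]. Hence the time derivative and the direction of [x1 - y1] are
   available. *)
have s_gt0 : 0 < s.
  rewrite lt_neqAle s0 andbT; apply/eqP => s00.
  move: Fs; rewrite -s00 FE// tauE mulr0.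
  have := transform_initial Lp x1 y1 (ltW Lp0) LipLp.
  have : 0 <= sg * enorm x1 ^+ 2 by rewrite mulr_ge0 ?sqr_ge0// ltW.
  by lra.
have z0 : 0 < enorm (x1 - y1).
  rewrite lt_neqAle enorm_ge0 andbT; apply/eqP => z0.
  have xy1 : x1 = y1 by apply/eqP; rewrite -subr_eq0; apply/eqP/enorm_eq0.
  move: Fs; rewrite FE// xy1 !subrr.
  have : 0 <= sg * enorm y1 ^+ 2 by rewrite mulr_ge0 ?sqr_ge0// ltW.
  have : 0 <= kap * s by rewrite mulr_ge0// ltW.
  by rewrite enorm0 mulr0; lra.
have Fmax' x' y' s' : 0 <= s' <= s ->
    U (v x' s') - U (v y' s') - decay k c tau s' * enorm (x' - y')
      - sg * enorm x' ^+ 2 - kap * s' <=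
    U (v x1 s) - U (v y1 s) - decay k c tau s * enorm (x1 - y1)
      - sg * enorm x1 ^+ 2 - kap * s.
  move=> /andP[s'0 s's]; rewrite -!FE//.
  by apply: Fmax; rewrite s'0 (le_trans s's).
have [r [rL r0]] := transform_test (decay k c tau) x1 y1 s sg kap s_gt0 sg0
  (Lam0 s s0) (is_derive_decay k c tau k0 c0 tau0 s s0) z0 Lu Fmax'.
have rho' : `|r - decay k c tau s| < rho.
  apply: le_lt_trans rL _.
  have : (sg * enorm x1) ^+ 2 < (rho / 2) ^+ 2.
    apply: le_lt_trans sgK; rewrite exprMn expr2 -mulrA.
    by rewrite ler_wpM2l// ltW.
  rewrite ltr_pXn2r// ?nnegrE ?mulr_ge0 ?enorm_ge0 ?(ltW sg0) ?(ltW rho0)//.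
  by lra.
have L01 : 0 <= decay k c tau s <= Lp by rewrite (ltW (Lam0 s s0)) LamLp.
have := rhoP _ r _ _ L01 r0 rho' (gP _ (inM x1 s s0)) (dgD _ (inM x1 s s0)).
(* The maximum test now reads [kap <= kap / 4 + kap / 2], a contradiction. *)
have : 2 * eps * N%:R * sg <= kap / 4.
  have : 0 <= eps * sg by rewrite mulr_ge0// ltW.
  by lra.
by lra.
Qed.

Lemma transformed_lipschitz_solution x y (t : R) : 0 < t ->
  v x t - v y t <= gmax * ((k * c * t) `^ (- k^-1) * enorm (x - y)).
Proof.
move=> t0; have /andP[x0 x1] := v0M x t (ltW t0).
have /andP[y0 y1] := v0M y t (ltW t0).
have gmax0 : 0 <= gmax.
  by have /andP[/(le_trans (ltW gmin0))/le_trans h /h] := gP _ (v0M x t (ltW t0)).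
have [yx|/ltW xy] := leP (v y t) (v x t).
  apply: le_trans (transform_expand _ _ y0 yx x1) _.
  by rewrite ler_wpM2l// transformed_lipschitz.
apply: (@le_trans _ _ 0); first by rewrite subr_le0.
by rewrite !mulr_ge0 ?powR_ge0 ?enorm_ge0.
Qed.

End TransformedLipschitz.

(** * Time derivative by comparison at two time scales *)

Section TimeDerivative.
Context {R : realType} {N : nat}.
Variables (H : R -> R) (eps K h t0 G : R) (w : 'rV[R]_N -> R -> R).
Hypotheses (eps0 : 0 < eps) (t00 : 0 <= t0) (K0 : 0 < K) (h0 : 0 <= h).
Hypothesis cH : {within `[0, +oo[, continuous H}.
Hypothesis solw : regular_solution H eps w.
Hypothesis wK : forall x y s t, 0 <= s -> 0 <= t -> w x s - w y t <= K.
Hypothesis wG : forall x y, w x t0 - w y t0 <= G * enorm (x - y).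
Hypothesis Hh : forall x t, t0 < t -> - H (enorm (grad (w ^~ t) x)) <= h.

(** The clock at [x] runs [mu^2] times as fast, so the Hamiltonians contribute
    [- mu^2 H(r) + H(2 A |x - y|)]. This splits into [(mu^2 - 1) (- H(r))], bounded through [h], and
    a difference of [H] at nearby arguments. The pair [(mu, 1)] in [doubling_test] produces exactly
    the weights of the two Laplacians. *)
Lemma scaled_test (x y : 'rV[R]_N) (s mu A sg kap C B : R) :
  0 < s -> 1 < mu -> 0 < sg -> 0 < A ->
  (forall x' y' s', 0 <= s' <= s ->
    w x' (t0 + mu ^+ 2 * s') - w y' (t0 + s') - A * enorm (x' - y') ^+ 2
      - sg * enorm x' ^+ 2 - (C + (B + kap) * s') <=
    w x (t0 + mu ^+ 2 * s) - w y (t0 + s) - A * enorm (x - y) ^+ 2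
      - sg * enorm x ^+ 2 - (C + (B + kap) * s)) ->
  exists r, [/\ `|r - 2 * A * enorm (x - y)| <= 2 * sg * enorm x, 0 <= r &
    B + kap <= 2 * N%:R * eps * (A * (mu - 1) ^+ 2 + sg * mu ^+ 2)
      + (mu ^+ 2 - 1) * h + (H (2 * A * enorm (x - y)) - H r)].
Proof.
move=> s0 mu1 sg0 A0 Fmax.
case: solw => _ dw ddw dwt.
have [tx txE] : exists tx, tx = t0 + mu ^+ 2 * s by eexists.
have [ty tyE] : exists ty, ty = t0 + s by eexists.
have mu20 : 0 < mu ^+ 2 by rewrite exprn_gt0// (lt_trans ltr01).
have tx0 : t0 < tx by rewrite txE ltrDl mulr_gt0.
have ty0 : t0 < ty by rewrite tyE ltrDl.
have tx0' : 0 <= tx by apply: le_trans (ltW tx0).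
have ty0' : 0 <= ty by apply: le_trans (ltW ty0).
have quad : forall x' y' : 'rV[R]_N,
    w x' tx - w y' ty - A * enorm (x' - y') ^+ 2 - sg * enorm x' ^+ 2 <=
    w x tx - w y ty - A * enorm (x - y) ^+ 2 - sg * enorm x ^+ 2.
  move=> x' y'; have := Fmax x' y' s; rewrite (ltW s0) lexx -txE -tyE.
  by move=> /(_ isT); lra.
have test i := doubling_test (w ^~ tx) _ (w ^~ ty) _ _ _ i x y mu 1 A sg
  (fun z => dw i z tx tx0') (ddw i x tx tx0') (fun z => dw i z ty ty0')
  (ddw i y ty ty0') quad.
have [q qE] : exists q, q = (2 * A) *: (x - y) by eexists.
have A20 : 0 < 2 * A by rewrite mulr_gt0.
have sg20 : 0 < 2 * sg by rewrite mulr_gt0.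
have nq : enorm q = 2 * A * enorm (x - y) by rewrite qE enormZ gtr0_norm.
have [r rE] : exists r, r = enorm (q + (2 * sg) *: x) by eexists.
have gx : grad (w ^~ tx) x = q + (2 * sg) *: x.
  by apply/rowP => i; rewrite qE !mxE; have [-> _ _] := test i; rewrite !mxE.
have gy : grad (w ^~ ty) y = q.
  by apply/rowP => i; rewrite qE !mxE; have [_ -> _] := test i; rewrite !mxE.
have lap : mu ^+ 2 * laplacian (w ^~ tx) x - laplacian (w ^~ ty) y <=
    2 * N%:R * (A * (mu - 1) ^+ 2 + sg * mu ^+ 2).
  rewrite /laplacian mulr_sumr -sumrB.
  have -> : 2 * N%:R * (A * (mu - 1) ^+ 2 + sg * mu ^+ 2) =
      \sum_(i < N) (2 * (A * (mu - 1) ^+ 2 + sg * mu ^+ 2)).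
    by rewrite sumr_const card_ord -[RHS]mulr_natr mulrAC.
  apply: ler_sum => i _; have [_ _] := test i.
  by rewrite expr1n mul1r mulrDr !mulrA.
have dF : is_derive s 1 (fun s => w x (t0 + mu ^+ 2 * s) - w y (t0 + s)
      - A * enorm (x - y) ^+ 2 - sg * enorm x ^+ 2 - (C + (B + kap) * s))
    ((eps * laplacian (w ^~ tx) x - H (enorm (grad (w ^~ tx) x))) * mu ^+ 2
     - (eps * laplacian (w ^~ ty) y - H (enorm (grad (w ^~ ty) y)))
     - (B + kap)).
  have l1 : is_derive s 1 (fun s : R => t0 + mu ^+ 2 * s) (mu ^+ 2).
    by apply: is_derive_eq; rewrite /GRing.scale/=; ring.
  have l2 : is_derive s 1 (fun s : R => t0 + s) 1.
    by apply: is_derive_eq; rewrite /GRing.scale/=; ring.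
  have e1 := dwt x tx (le_lt_trans t00 tx0).
  have e2 := dwt y ty (le_lt_trans t00 ty0).
  rewrite {1}txE in e1; rewrite {1}tyE in e2.
  have d1 := @is_derive1_comp R (w x) _ s _ _ e1 l1.
  have d2 := @is_derive1_comp R (w y) _ s _ _ e2 l2.
  apply: is_derive_eq; rewrite /GRing.scale/= !(mulr0, subr0, addr0, add0r).
  by rewrite !(mulr1, mul1r).
have := derive_ge0_left _ s _ s0 dF (fun s' ss => Fmax x y s' ss).
rewrite gx gy -rE nq => dt.
exists r; split.
- have := enorm_dist q ((2 * sg) *: x).
  by rewrite -rE nq enormZ [`|2 * sg|]gtr0_norm.
- by rewrite rE enorm_ge0.
have := Hh x tx tx0; rewrite gx -rE => Hr.
have {}Hr : (mu ^+ 2 - 1) * - H r <= (mu ^+ 2 - 1) * h.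
  by rewrite ler_wpM2l// subr_ge0 exprn_ege1// ltW.
have {}lap : eps * (mu ^+ 2 * laplacian (w ^~ tx) x - laplacian (w ^~ ty) y) <=
    eps * (2 * N%:R * (A * (mu - 1) ^+ 2 + sg * mu ^+ 2)).
  by rewrite ler_wpM2l// ltW.
move: dt Hr lap; move: (laplacian _ x) (laplacian _ y) (H r) (H _).
by move=> lx ly h1 h2 dt Hr lap; lra.
Qed.

Lemma scaled_comparison (mu A : R) x y (s : R) : 1 < mu -> 0 < A -> 0 <= s ->
  w x (t0 + mu ^+ 2 * s) - w y (t0 + s) <= A * enorm (x - y) ^+ 2
    + G ^+ 2 / (4 * A)
    + (2 * N%:R * eps * (A * (mu - 1) ^+ 2) + (mu ^+ 2 - 1) * h) * s.
Proof.
move=> mu1 A0 s0; rewrite leNgt; apply/negP => viol.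
have mu20 : 0 < mu ^+ 2 by rewrite exprn_gt0// (lt_trans ltr01).
have [B BE] : exists B, B = 2 * N%:R * eps * (A * (mu - 1) ^+ 2)
    + (mu ^+ 2 - 1) * h by eexists.
have [C CE] : exists C, C = G ^+ 2 / (4 * A) by eexists.
rewrite -BE -CE in viol.
(* Young's inequality [G z <= A z^2 + G^2 / (4 A)] starts the comparison at [t0]. *)
have init x' y' : w x' t0 - w y' t0 <= A * enorm (x' - y') ^+ 2 + C.
  apply: le_trans (wG x' y') _.
  have -> : A * enorm (x' - y') ^+ 2 + C = G * enorm (x' - y')
      + A * (enorm (x' - y') - G / (2 * A)) ^+ 2.
    by rewrite CE; field; rewrite gt_eqF.
  by rewrite lerDl mulr_ge0 ?sqr_ge0// ltW.
have s_gt0 : 0 < s.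
  rewrite lt_neqAle s0 andbT; apply/eqP => s00; move: viol.
  by rewrite -s00 !mulr0 !addr0 ltNge init.
have [gap gapE] : exists gap, gap = w x (t0 + mu ^+ 2 * s) - w y (t0 + s)
    - (A * enorm (x - y) ^+ 2 + C + B * s) by eexists.
have gap0 : 0 < gap by rewrite gapE subr_gt0.
have [kap kapE] : exists kap, kap = gap / (4 * s) by eexists.
have kap0 : 0 < kap by rewrite kapE divr_gt0// mulr_gt0.
have kaps : kap * s = gap / 4 by rewrite kapE; field; rewrite gt_eqF.
have k4 : 0 < kap / 4 by rewrite divr_gt0.
(* At a positive maximum [A |x - y|^2 <= K], so the gradient length [q = 2 A |x - y|] satisfies
   [q^2 <= 4 A K], whence [q <= 4 A K + 1]. *)
have [d d0 dP] := unif_continuous_segment H (4 * A * K + 1) _ cH k4.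
have X0 : 0 < 4 * (enorm x ^+ 2 + 1) by rewrite mulr_gt0// ltr_wpDl ?sqr_ge0.
have N1 : 0 < N%:R + 1 :> R by rewrite ltr_wpDl.
have N0 : 0 < 8 * eps * (N%:R + 1) * mu ^+ 2.
  by rewrite pmulr_lgt0// !mulr_gt0.
have [sg [sg0 sgX sgN sgK]] := exists_lt3 (gap / (4 * (enorm x ^+ 2 + 1)))
  (kap / (8 * eps * (N%:R + 1) * mu ^+ 2)) ((d / 2) ^+ 2 / K)
  (divr_gt0 gap0 X0) (divr_gt0 kap0 N0)
  (divr_gt0 (exprn_gt0 2 (divr_gt0 d0 (ltr0n R 2))) K0).
rewrite ltr_pdivlMr// in sgX; rewrite ltr_pdivlMr// in sgN.
rewrite ltr_pdivlMr// in sgK.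
pose F (x y : 'rV[R]_N) (s : R) :=
  w x (Num.max (t0 + mu ^+ 2 * Num.max s 0) 0)
  - w y (Num.max (t0 + Num.max s 0) 0)
  - A * enorm (x - y) ^+ 2 - sg * enorm x ^+ 2
  - (C + (B + kap) * Num.max s 0).
have tx s' : 0 <= s' -> 0 <= t0 + mu ^+ 2 * s'.
  by move=> s'0; rewrite addr_ge0// mulr_ge0// ltW.
have ty s' : 0 <= s' -> 0 <= t0 + s' by move=> s'0; rewrite addr_ge0.
have FE x' y' s' : 0 <= s' -> F x' y' s' =
    w x' (t0 + mu ^+ 2 * s') - w y' (t0 + s')
    - A * enorm (x' - y') ^+ 2 - sg * enorm x' ^+ 2 - (C + (B + kap) * s').
  by move=> s'0; rewrite /F (max_l s'0) max_l ?tx// max_l ?ty.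
have cF : continuous (fun p : 'rV[R]_N * 'rV[R]_N * R => F p.1.1 p.1.2 p.2).
  have c11 : continuous (fun p : 'rV[R]_N * 'rV[R]_N * R => p.1.1).
    exact: continuous_composite continuous_fst continuous_fst.
  have c12 : continuous (fun p : 'rV[R]_N * 'rV[R]_N * R => p.1.2).
    exact: continuous_composite continuous_fst continuous_snd.
  have cm : continuous (fun p : 'rV[R]_N * 'rV[R]_N * R => Num.max p.2 0).
    exact: continuous_composite continuous_snd continuous_max0.
  have ctx : continuous (fun p : 'rV[R]_N * 'rV[R]_N * R =>
      t0 + mu ^+ 2 * Num.max p.2 0).
    by move=> p; apply: cvgD; [exact: cvg_cst|exact: (cvgMl_tmp (cm p))].
  have cty : continuous (fun p : 'rV[R]_N * 'rV[R]_N * R =>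
      t0 + Num.max p.2 0).
    by move=> p; apply: cvgD; [exact: cvg_cst|exact: cm].
  have [cw _ _ _] := solw.
  have cw1 := continuous_composite _ _ (continuous_pairing _ _ c11 ctx) cw.
  have cw2 := continuous_composite _ _ (continuous_pairing _ _ c12 cty) cw.
  have cz : continuous (fun p : 'rV[R]_N * 'rV[R]_N * R =>
      enorm (p.1.1 - p.1.2)).
    by apply: continuous_enorm => p; exact: (cvgB (c11 p) (c12 p)).
  have cx := continuous_enorm _ _ c11.
  move=> p; apply: cvgB; last first.
    by apply: cvgD; [exact: cvg_cst|exact: (cvgMl_tmp (cm p))].
  apply: cvgB; last exact: (cvgMl_tmp (cvgM (cx p) (cx p))).
  apply: cvgB; last exact: (cvgMl_tmp (cvgM (cz p) (cz p))).
  exact: (cvgB (cw1 p) (cw2 p)).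
have Fpos : 0 < F x y s.
  rewrite FE// mulrDl kaps.
  have : sg * enorm x ^+ 2 <= gap / 4 by nra.
  by rewrite gapE; lra.
have C0 : 0 <= C by rewrite CE divr_ge0 ?sqr_ge0// mulr_ge0// ltW.
have Bkap0 : 0 <= B + kap.
  rewrite addr_ge0 ?(ltW kap0)// BE addr_ge0//.
    apply: mulr_ge0; first by rewrite mulr_ge0 ?(ltW eps0)// mulr_ge0.
    by rewrite mulr_ge0 ?sqr_ge0// ltW.
  by rewrite mulr_ge0// subr_ge0 exprn_ege1// ltW.
have sgx x' y' s' : 0 <= s' -> 0 < F x' y' s' ->
    sg * enorm x' ^+ 2 <= K /\ A * enorm (x' - y') ^+ 2 <= K.
  move=> s'0; rewrite FE// => F0.
  have h1 := wK x' y' _ _ (tx s' s'0) (ty s' s'0).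
  have h2 : 0 <= A * enorm (x' - y') ^+ 2 by rewrite mulr_ge0 ?sqr_ge0// ltW.
  have h3 : 0 <= sg * enorm x' ^+ 2 by rewrite mulr_ge0 ?sqr_ge0// ltW.
  have h4 : 0 <= (B + kap) * s' by rewrite mulr_ge0.
  by split; lra.
have bF x' y' s' : 0 <= s' <= s -> 0 < F x' y' s' ->
    forall i, `|x' 0 i| <= K / sg + 1 + (K / A + 1) /\
      `|y' 0 i| <= K / sg + 1 + (K / A + 1).
  move=> /andP[s'0 _] F0; have [h1 h2] := sgx x' y' s' s'0 F0.
  have root u m : 0 < m -> m * u ^+ 2 <= K -> u <= K / m + 1.
    move=> m0; rewrite mulrC -ler_pdivlMr// => um.
    by have := sqr_ge0 (u - 1); nra.
  have hx := root _ _ sg0 h1; have hz := root _ _ A0 h2.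
  have hy : enorm y' <= enorm x' + enorm (x' - y').
    by have := enormD x' (- (x' - y')); rewrite enormN opprB addrC subrK.
  have hz0 := enorm_ge0 (x' - y').
  move=> i; have := coord_le_enorm x' i; have := coord_le_enorm y' i.
  by split; lra.
have ss : 0 <= s <= s by rewrite s0/=.
have [x1 [y1 [s1 [/andP[s10 s1s] Fs Fmax]]]] :=
  doubling_max F s _ x y s cF bF ss Fpos.
have [sgx1 Az1] := sgx x1 y1 s1 s10 Fs.
have s1_gt0 : 0 < s1.
  rewrite lt_neqAle s10 andbT; apply/eqP => s00.
  move: Fs; rewrite -s00 FE// !mulr0 !addr0.
  have := init x1 y1.
  have : 0 <= sg * enorm x1 ^+ 2 by rewrite mulr_ge0 ?sqr_ge0// ltW.
  by lra.
have Fmax' x' y' s' : 0 <= s' <= s1 ->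
    w x' (t0 + mu ^+ 2 * s') - w y' (t0 + s') - A * enorm (x' - y') ^+ 2
      - sg * enorm x' ^+ 2 - (C + (B + kap) * s') <=
    w x1 (t0 + mu ^+ 2 * s1) - w y1 (t0 + s1) - A * enorm (x1 - y1) ^+ 2
      - sg * enorm x1 ^+ 2 - (C + (B + kap) * s1).
  move=> /andP[s'0 s's]; rewrite -!FE//.
  by apply: Fmax; rewrite s'0 (le_trans s's).
have [r [rL r0]] := scaled_test x1 y1 s1 mu A sg kap C B s1_gt0 mu1 sg0 A0 Fmax'.
have rd : `|2 * A * enorm (x1 - y1) - r| < d.
  rewrite distrC; apply: le_lt_trans rL _.
  have : (sg * enorm x1) ^+ 2 < (d / 2) ^+ 2.
    apply: le_lt_trans sgK; rewrite exprMn expr2 -mulrA.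
    by rewrite ler_wpM2l// ltW.
  rewrite ltr_pXn2r// ?nnegrE ?mulr_ge0 ?enorm_ge0 ?(ltW sg0) ?divr_ge0 ?(ltW d0)//.
  by lra.
have L01 : 0 <= 2 * A * enorm (x1 - y1) <= 4 * A * K + 1.
  rewrite !mulr_ge0 ?enorm_ge0 ?(ltW A0)//=.
  have : A * (A * enorm (x1 - y1) ^+ 2) <= A * K by rewrite ler_wpM2l// ltW.
  by have := sqr_ge0 (2 * A * enorm (x1 - y1) - 1); nra.
have := dP _ _ L01 r0 rd; rewrite ltr_norml => /andP[_ Hd].
have : 2 * N%:R * eps * (sg * mu ^+ 2) <= kap / 4.
  have : 0 <= eps * sg * mu ^+ 2.
    by rewrite mulr_ge0 ?(ltW mu20)// mulr_ge0// ltW.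
  by lra.
by rewrite BE; lra.
Qed.

Lemma time_derivative_le x (t l B : R) : t0 < t -> 0 < B ->
  is_derive t 1 (w x) l ->
  l <= G ^+ 2 / (4 * B * (t - t0)) + N%:R * B * eps / 2 + h.
Proof.
move=> tt B0 [/cvg_ex[l' wl'] <-]; rewrite /derive (cvg_lim _ wl')//.
apply: (cvgr_to_le (cvg_dnbhs_at_right wl')); near=> d.
have d0 : 0 < d by near: d; exact: nbhs_right_gt.
rewrite /= [d *: 1]mulr1 [_ *: _]mulrC ler_pdivrMr//.
have [s sE] : exists s, s = t - t0 by eexists.
have s0 : 0 < s by rewrite sE subr_gt0.
have ds0 : 0 < d / s by rewrite divr_gt0.
(* With [s = t - t0], this scaling places the fast clock at [t + d] and the slow one at [t]. *)
have [mu [mu1 mu2]] : exists mu, 1 < mu /\ mu ^+ 2 = 1 + d / s.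
  exists (Num.sqrt (1 + d / s)); split; last by rewrite sqr_sqrtr// addr_ge0// ltW.
  by rewrite -[ltLHS]sqrtr1 ltr_sqrt ?ltrDl// addr_gt0.
have A0 : 0 < B * s / d by rewrite divr_gt0// mulr_gt0.
have := scaled_comparison mu (B * s / d) x x s mu1 A0 (ltW s0).
have -> : t0 + mu ^+ 2 * s = d + t by rewrite mu2 sE; field; rewrite subr_eq0 gt_eqF.
have -> : t0 + s = t by rewrite sE addrC subrK.
rewrite subrr enorm0 expr0n mulr0 add0r -sE mu2 => /le_trans; apply.
(* Since [mu + 1 >= 2], the identity [mu^2 - 1 = d / s] gives [mu - 1 <= d / (2 s)]. *)
have mu3 : (mu - 1) ^+ 2 <= (d / s) ^+ 2 / 4.
  have -> : d / s = (mu - 1) * (mu + 1) by rewrite -subr_sqr mu2; ring.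
  have : 0 <= (mu - 1) ^+ 2 by rewrite sqr_ge0.
  have : 4 <= (mu + 1) ^+ 2 by nra.
  by rewrite exprMn; nra.
have mu4 : 2 * N%:R * eps * (B * s / d * (mu - 1) ^+ 2) <=
    2 * N%:R * eps * (B * s / d * ((d / s) ^+ 2 / 4)).
  apply: ler_wpM2l; first by rewrite mulr_ge0 ?(ltW eps0)// mulr_ge0.
  by apply: ler_wpM2l => //; exact: ltW.
have -> : (G ^+ 2 / (4 * B * s) + N%:R * B * eps / 2 + h) * d =
    G ^+ 2 / (4 * (B * s / d)) + (2 * N%:R * eps * (B * s / d * ((d / s) ^+ 2 / 4))
      + (1 + d / s - 1) * h) * s.
  by field; rewrite !gt_eqF.
rewrite lerD2l; apply: ler_wpM2r; first exact: ltW.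
by rewrite lerD2r.
Unshelve. all: by end_near. Qed.

End TimeDerivative.

(** * From partial derivatives to Lipschitz bounds and back *)

Section MeanValue.
Context {R : realType} {N : nat}.
Implicit Types (f : 'rV[R]_N -> R) (x xi : 'rV[R]_N).

(** The path from [x] to [x + xi] changes one coordinate at a time, so the one-variable mean value
    theorem applies on each leg without total differentiability. *)
Lemma mean_value_coord f x xi :
  (forall i z, is_derive z (delta_mx 0 i) f (partial i f z)) ->
  exists c : 'I_N -> 'rV[R]_N,
    (forall i j, `|c i 0 j - x 0 j| <= `|xi 0 j|) /\
    f (x + xi) - f x = \sum_i xi 0 i * partial i f (c i).
Proof.
move=> df.
pose X (k : nat) : 'rV[R]_N := x + \row_j (if (j < k)%N then xi 0 j else 0).
have XS (i : 'I_N) : X i.+1 = X i + xi 0 i *: delta_mx 0 i.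
  rewrite /X -addrA; congr (_ + _); apply/rowP => j; rewrite !mxE eqxx/=.
  rewrite ltnS leq_eqVlt; have [->|ji] := eqVneq j i.
    by rewrite eqxx/= ltnn add0r mulr1.
  by rewrite val_eqE (negbTE ji)/= mulr0 addr0.
have /choice[c cP] : forall i : 'I_N, exists c : 'rV[R]_N,
    (forall j, `|c 0 j - x 0 j| <= `|xi 0 j|) /\
    f (X i.+1) - f (X i) = xi 0 i * partial i f c.
  move=> i.
  pose y (s : R) : 'rV[R]_N := X i + (xi 0 i * s) *: delta_mx 0 i.
  have dy (s : R) : is_derive s 1 (fun s => f (y s)) (xi 0 i * partial i f (y s)).
    have d1 := is_derive_lineP f _ (X i) (delta_mx 0 i) (df i) (xi 0 i * s).
    have d2 : is_derive s 1 (fun s : R => xi 0 i * s) (xi 0 i).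
      by apply: is_derive_eq; rewrite /GRing.scale/= mulr1.
    by rewrite mulrC; exact: (@is_derive1_comp R _ _ s _ _ d1 d2).
  have cy : {within `[0, 1], continuous (fun s => f (y s))}.
    by apply: derivable_within_continuous => s _; case: (dy s).
  have [s] := MVT ltr01 (fun s _ => dy s) cy.
  rewrite in_itv/= => /andP[s0 s1].
  rewrite /y mulr1 mulr0 scale0r addr0 -XS subr0 mulr1 => fE.
  exists (y s); split=> // j.
  have -> : y s 0 j - x 0 j =
      (if (j < i)%N then xi 0 j else 0) + xi 0 i * s * (j == i)%:R.
    by rewrite !mxE eqxx/=; ring.
  have [->|ji] := eqVneq j i.
    rewrite ltnn add0r mulr1 normrM (gtr0_norm s0).
    by rewrite ler_piMr// ltW.
  by rewrite mulr0 addr0; case: ifP => // _; rewrite normr0.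
exists c; split; first by move=> i; have [] := cP i.
transitivity (\sum_(i < N) (f (X i.+1) - f (X i))).
  have XN : X N = x + xi.
    by congr (_ + _); apply/rowP => j; rewrite !mxE ltn_ord.
  have X0 : X 0%N = x.
    by rewrite -[RHS]addr0; congr (_ + _); apply/rowP => j; rewrite !mxE.
  rewrite -(big_mkord xpredT (fun i => f (X i.+1) - f (X i))).
  by rewrite (telescope_sumr (fun i => f (X i)))// XN X0.
by apply: eq_bigr => i _; have [] := cP i.
Qed.

Lemma lipschitz_of_partial f :
  (forall i z, is_derive z (delta_mx 0 i) f (partial i f z)) ->
  (forall i, bounded_fun (partial i f)) ->
  exists L, forall x y, f x - f y <= L * enorm (x - y).
Proof.
move=> df bf.
have /choice[B BP] : forall i, exists B, forall z, `|partial i f z| <= B.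
  move=> i; have [M [_ MP]] := bf i; exists (M + 1) => z.
  by apply: MP => //; rewrite ltrDl.
exists (\sum_i B i) => x y.
have [c [_ fE]] := mean_value_coord f y (x - y) df.
have yx : y + (x - y) = x by rewrite addrC subrK.
rewrite yx in fE; rewrite fE mulr_suml; apply: ler_sum => i _.
apply: le_trans (ler_norm _) _; rewrite normrM mulrC.
by apply: ler_pM => //; exact: coord_le_enorm.
Qed.

(** A short step [h grad f(x)] raises [f] by nearly [h |grad f(x)|^2], because continuous partials
    change little on the coordinate path; the Lipschitz bound allows only [L h |grad f(x)|]. *)
Lemma enorm_grad_le f (L : R) x :
  (forall i z, is_derive z (delta_mx 0 i) f (partial i f z)) ->
  (forall i, continuous (partial i f)) -> 0 <= L ->
  (forall x y, f x - f y <= L * enorm (x - y)) -> enorm (grad f x) <= L.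
Proof.
move=> df cf L0 fL; set n := enorm (grad f x).
have [n0|n0] := eqVneq n 0; first by rewrite n0.
have npos : 0 < n by rewrite lt_neqAle eq_sym n0 enorm_ge0.
have S0 : 0 < \sum_(i < N) n + 1 by rewrite ltr_wpDl// sumr_ge0// => i _; exact: ltW.
suff: n ^+ 2 <= L * n by rewrite expr2 ler_pM2r.
apply/ler_addgt0Pr => e e0.
(* Each of the [N] coordinates costs at most [n] times this amount, so the total stays below [e];
   the added 1 makes room for the strict inequality. *)
have e1 : 0 < e / (\sum_(i < N) n + 1) by rewrite divr_gt0.
have : \forall h \near (0 : R)^'+, forall (i : 'I_N) (z : 'rV[R]_N),
    (forall j, `|z 0 j - x 0 j| <= h * n) ->
    `|partial i f x - partial i f z| < e / (\sum_(i < N) n + 1).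
  apply: filter_forall => i.
  have /cvgrPdist_lt/(_ _ e1) := cf i x.
  move=> /nbhs_ballP[d /= d0 dP]; near=> h => z zh; apply: dP.
  split=> // k j; rewrite (ord1 k) /ball/= distrC.
  apply: le_lt_trans (zh j) _; rewrite -ltr_pdivlMr//.
  by near: h; apply: nbhs_right_lt; rewrite divr_gt0.
move=> near_h.
near (0 : R)^'+ => h.
have h0 : 0 < h by near: h; exact: nbhs_right_gt.
have [c [cP fE]] := mean_value_coord f x (h *: grad f x) df.
have hP : forall (i : 'I_N) (z : 'rV[R]_N), (forall j, `|z 0 j - x 0 j| <= h * n) ->
    `|partial i f x - partial i f z| < e / (\sum_(i < N) n + 1).
  by near: h.
have := fL (x + h *: grad f x) x.
have -> : x + h *: grad f x - x = h *: grad f x by rewrite addrC addKr.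
rewrite fE enormZ (gtr0_norm h0) -/n.
move=> fLh.
suff key : h * n ^+ 2 - \sum_i (h *: grad f x) 0 i * partial i f (c i) <= h * e.
  by rewrite -(ler_pM2l h0); lra.
rewrite /n sqr_enorm mulr_sumr -sumrB -/n.
apply: (@le_trans _ _ (\sum_(i < N) h * (n * (e / (\sum_(i < N) n + 1))))).
  apply: ler_sum => i _; rewrite !mxE.
  have pn := coord_le_enorm (grad f x) i; rewrite mxE in pn.
  have ci : forall j, `|c i 0 j - x 0 j| <= h * n.
    move=> j; apply: le_trans (cP i j) _; rewrite mxE normrM gtr0_norm//.
    by rewrite ler_pM2l// coord_le_enorm.
  have -> : h * partial i f x ^+ 2 - h * partial i f x * partial i f (c i) =
      h * (partial i f x * (partial i f x - partial i f (c i))) by ring.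
  rewrite ler_pM2l//; apply: le_trans (ler_norm _) _; rewrite normrM.
  by apply: ler_pM => //; exact/ltW/hP.
rewrite -mulr_sumr ler_pM2l// -mulr_suml mulrA ler_pdivrMr//.
by rewrite mulrC ler_pM2l// lerDl.
Unshelve. all: by end_near.
Qed.

Lemma Linf_norm_le f (B : R) : (0 < N)%N ->
  (forall x, `|f x| <= B) -> (Linf_norm f <= B%:E)%E.
Proof.
move=> N0 fB; apply: ereal_inf_lbound; exists B => //= e e0.
(* The exceptional set is empty and degenerate boxes cover it. Their volume is 0 because [N > 0]; in
   dimension 0 the empty product would be 1. *)
exists (fun=> 0), (fun=> 0); split=> [k i|x /=|].
- by rewrite lexx.
- by rewrite ltNge fB.
- rewrite eseries0 ?lee_fin ?ltW// => k _ _.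
  by rewrite (bigD1 (Ordinal N0))//= mxE subrr mul0r.
Qed.

Lemma grad_norm_le f (B : R) : (0 < N)%N ->
  (forall x, enorm (grad f x) <= B) -> (grad_norm f <= B%:E)%E.
Proof.
by move=> N0 fB; apply: Linf_norm_le => // x; rewrite ger0_norm ?enorm_ge0.
Qed.

End MeanValue.

(** * The concrete transforms for both ranges of p, and positivity *)

Section Estimates.
Context {R : realType} {N : nat}.
Variables (p a b gamma eps M Lip : R) (H : R -> R) (Phi : R -> R -> R).
Variable v : 'rV[R]_N -> R -> R.
Hypotheses (p0 : 0 < p) (p1 : p != 1) (eps0 : 0 < eps).
Hypothesis basicH : basic_assumption H Phi.
Hypothesis pcondH : p_condition p Phi a b gamma.
Hypothesis solv : regular_solution H eps v.
Hypothesis v0M : forall x t, 0 <= t -> 0 <= v x t <= M.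
Hypothesis vLip : forall x y, v x 0 - v y 0 <= Lip * enorm (x - y).

Let a0 : 0 < a. Proof. by case: pcondH. Qed.
Let cH : {within `[0, +oo[, continuous H}. Proof. by case: basicH => -[]. Qed.

Lemma slope_growth_scaled (g1 g2 L : R) : 0 < L -> 0 < g2 -> g2 <= g1 ->
  a / (p - 1) * (L `^ p * (g1 `^ (p - 1) - g2 `^ (p - 1))) <=
  Num.sg (p - 1) * (H (g1 * L) / g1 - H (g2 * L) / g2).
Proof.
move=> L0 g20 g21; have g10 : 0 < g1 by exact: lt_le_trans g21.
have := slope_growth H Phi p a b gamma (g2 * L) (g1 * L) p1 basicH pcondH.
rewrite mulr_gt0// ler_pM2r// => /(_ isT g21).
rewrite !powRM ?(ltW g10) ?(ltW g20) ?(ltW L0)// -mulrBl.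
rewrite -(ler_pM2r L0) -!mulrA -(mulr_powRB1 (ltW L0) p0).
congr (_ <= _); first by ring.
by field; rewrite !gt_eqF.
Qed.

(** The power [1/p] is the one for which [g^(p-1)] is a multiple of [U], so [slope_growth_scaled] is
    already the structure condition; concavity of [g] gives the quadratic term the right sign. *)
Lemma lipschitz_gt1 (d : R) x y (t : R) : 1 < p -> 0 < d -> 0 < t ->
  (v x t + d) `^ ((p - 1) / p) - (v y t + d) `^ ((p - 1) / p) <=
    mu_ p a * t `^ (- p^-1) * enorm (x - y) /\
  v x t - v y t <= (M + d) `^ p^-1 * (a * t) `^ (- p^-1) * enorm (x - y).
Proof.
move=> p_gt1 d0 t0.
have p10 : 0 < p - 1 by rewrite subr_gt0.
have pN0 : p != 0 by rewrite gt_eqF.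
have p1N0 : p - 1 != 0 by rewrite gt_eqF.
have [q qE] : exists q, q = p / (p - 1) by eexists.
have q0 : 0 < q by rewrite qE divr_gt0.
have sd s : 0 <= s <= M -> 0 < s + d by move=> /andP[s0 _]; rewrite ltr_wpDl.
have dsd (s : R) : is_derive s 1 (fun s => s + d) 1.
  by apply: is_derive_eq; rewrite addr0.
have dpow (s r : R) : 0 <= s <= M ->
    is_derive s 1 (fun s => (s + d) `^ r) (r * (s + d) `^ (r - 1)).
  move=> sM; have dp := is_derive1_powR r (sd s sM).
  have := @is_derive1_comp R (fun s : R => s `^ r) _ s _ _ dp (dsd s).
  by rewrite mulr1.
pose U (s : R) := (s + d) `^ ((p - 1) / p).
pose g (s : R) := q * (s + d) `^ p^-1.
pose dg (s : R) := q * (p^-1 * (s + d) `^ (p^-1 - 1)).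
pose c := a * q `^ (p - 1) / (p - 1).
have c0 : 0 < c by rewrite divr_gt0// mulr_gt0// powR_gt0.
have dU (s : R) : 0 <= s <= M -> is_derive s 1 U (g s)^-1.
  move=> sM; apply: (is_derive_eq (dpow s _ sM)).
  have -> : (p - 1) / p - 1 = - p^-1 by field.
  by rewrite powRN /g qE invfM invf_div.
have dgP (s : R) : 0 <= s <= M -> is_derive s 1 g (dg s).
  by move=> sM; have := dpow s p^-1 sM => ?; exact: is_deriveZ.
have gmin0 : 0 < q * d `^ p^-1 by rewrite mulr_gt0// powR_gt0.
have gP (s : R) : 0 <= s <= M ->
    q * d `^ p^-1 <= g s <= q * (M + d) `^ p^-1.
  move=> sM; have s_gt0 := sd s sM; case/andP: sM => s0 sM.
  rewrite /g !ler_pM2l//; apply/andP; split.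
    apply: ge0_ler_powR; rewrite ?invr_ge0 ?nnegrE ?(ltW p0) ?(ltW d0)//.
      exact: ltW.
    by rewrite lerDr.
  apply: ge0_ler_powR; rewrite ?invr_ge0 ?nnegrE ?(ltW p0) ?(ltW s_gt0)//.
    by rewrite addr_ge0 ?(ltW d0)// (le_trans s0).
  by rewrite lerD2r.
have powN s1 s2 : 0 < s2 -> s2 <= s1 -> s1 `^ (p^-1 - 1) <= s2 `^ (p^-1 - 1).
  move=> s20 s21; have s10 := lt_le_trans s20 s21.
  have -> : p^-1 - 1 = - (1 - p^-1) by rewrite opprB.
  rewrite !powRN lef_pV2 ?posrE ?powR_gt0//.
  apply: ge0_ler_powR; rewrite ?nnegrE ?(ltW s10) ?(ltW s20)//.
  by rewrite subr_ge0 invf_le1// ltW.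
have dgD (s : R) : 0 <= s <= M -> `|dg s| <= q * (p^-1 * d `^ (p^-1 - 1)).
  move=> sM; rewrite ger0_norm ?mulr_ge0 ?powR_ge0 ?invr_ge0 ?(ltW q0) ?(ltW p0)//.
  rewrite /dg ler_pM2l// ler_pM2l ?invr_gt0//; apply: powN => //.
  by case/andP: sM => s0 _; rewrite lerDr.
have structure s1 s2 L : 0 <= s2 -> s2 <= s1 -> s1 <= M -> 0 < L ->
    c * L `^ p * (U s1 - U s2) <=
    H (g s1 * L) / g s1 - H (g s2 * L) / g s2 + eps * (dg s2 - dg s1) * L ^+ 2.
  move=> s20 s21 s1M L0.
  have s1M' : 0 <= s1 <= M by rewrite (le_trans s20).
  have s2M' : 0 <= s2 <= M by rewrite s20 (le_trans s21).
  have g20 : 0 < g s2 by rewrite mulr_gt0// powR_gt0// sd.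
  have g21 : g s2 <= g s1.
    rewrite /g ler_pM2l//; apply: ge0_ler_powR;
    by rewrite ?invr_ge0 ?nnegrE ?(ltW p0) ?(ltW (sd _ _))// lerD2r.
  have := slope_growth_scaled (g s1) (g s2) L L0 g20 g21.
  rewrite gtr0_sg// mul1r.
  have gE r : 0 <= r <= M -> g r `^ (p - 1) = q `^ (p - 1) * U r.
    move=> rM; rewrite /g powRM ?powR_ge0 ?(ltW q0)// -powRrM.
    by rewrite [p^-1 * _]mulrC.
  rewrite !gE// -mulrBr => hH.
  have dg21 : 0 <= eps * (dg s2 - dg s1) * L ^+ 2.
    rewrite mulr_ge0 ?sqr_ge0// mulr_ge0 ?(ltW eps0)// subr_ge0 /dg.
    by rewrite ler_pM2l// ler_pM2l ?invr_gt0// powN ?sd// lerD2r.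
  apply: le_trans (_ : _ <= H (g s1 * L) / g s1 - H (g s2 * L) / g s2) _.
    by apply: le_trans hH; rewrite /c le_eqVlt; apply/orP; left; apply/eqP; ring.
  by rewrite lerDl.
(* As [p c = a q^p], the factor [q^-1] appears. In the bound for [U] it yields [mu_]; in the bound
   for [v] it cancels the [q] in [gmax], so that [lambda_] is 1. *)
have ctE : (p * c * t) `^ (- p^-1) = q^-1 * (a * t) `^ (- p^-1).
  have -> : p * c * t = q `^ p * (a * t).
    by rewrite /c -(mulr_powRB1 (ltW q0) p0) {2}qE; field.
  rewrite powRM ?powR_ge0 ?mulr_ge0 ?(ltW a0) ?(ltW t0)//.
  by rewrite -powRrM mulrN mulfV// powR_inv1// ltW.
split.
  have := transformed_lipschitz H U g dg eps M p c _ _ _ Lip v eps0 p0 c0 gmin0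
    cH solv v0M vLip dU dgP gP dgD structure x y t t0.
  rewrite /U ctE /mu_ qE invf_div powRM ?(ltW a0) ?(ltW t0)//.
  move/le_trans; apply; rewrite le_eqVlt; apply/orP; left; apply/eqP.
  by ring.
have := transformed_lipschitz_solution H U g dg eps M p c _ _ _ Lip v eps0 p0
  c0 gmin0 cH solv v0M vLip dU dgP gP dgD structure x y t t0.
rewrite ctE; move/le_trans; apply; rewrite le_eqVlt; apply/orP; left; apply/eqP.
by field; rewrite gt_eqF.
Qed.

(** For [p < 1] the slope inequality is reversed, so [g] has to decrease. The choice [g' = - 1 / g]
    allows [U = - g] and keeps [g] concave. *)
Lemma lipschitz_lt1 (d : R) x y (t : R) : p < 1 -> 0 < d -> 0 < t ->
  v x t - v y t <=
    (2 / p) `^ p^-1 * (M + d) `^ p^-1 * (a * t) `^ (- p^-1) * enorm (x - y).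
Proof.
move=> p_lt1 d0 t0.
have p10 : p - 1 < 0 by rewrite subr_lt0.
have pN0 : p != 0 by rewrite gt_eqF.
have M0 : 0 <= M by have /andP[/le_trans h /h] := v0M x t (ltW t0).
have sd s : 0 <= s <= M -> 0 < 2 * (M + d - s).
  by move=> /andP[_ sM]; lra.
pose g (s : R) := Num.sqrt (2 * (M + d - s)).
pose U (s : R) := - g s.
have gmin0 : 0 < Num.sqrt (2 * d) by rewrite sqrtr_gt0 mulr_gt0.
have g_gt0 s : 0 <= s <= M -> 0 < g s by move=> sM; rewrite sqrtr_gt0 sd.
have [A AE] : exists A, A = Num.sqrt (2 * (M + d)) by eexists.
have A0 : 0 < A by rewrite AE sqrtr_gt0 mulr_gt0// ltr_wpDl.
have dgP (s : R) : 0 <= s <= M -> is_derive s 1 g (- (g s)^-1).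
  move=> sM.
  have d1 : is_derive s 1 (fun s : R => 2 * (M + d - s)) (- 2).
    by apply: is_derive_eq; rewrite /GRing.scale/=; ring.
  have d2 := is_derive1_sqrt (sd s sM).
  apply: (is_derive_eq (@is_derive1_comp R _ _ s _ _ d2 d1)).
  by rewrite -/(g s); field; rewrite gt_eqF ?g_gt0.
have dU (s : R) : 0 <= s <= M -> is_derive s 1 U (g s)^-1.
  by move=> sM; have := dgP s sM => ?; apply: is_derive_eq; rewrite opprK.
have gP (s : R) : 0 <= s <= M -> Num.sqrt (2 * d) <= g s <= A.
  move=> /andP[s0 sM]; rewrite /g AE !ler_wsqrtr// ler_pM2l//; lra.
have dgD (s : R) : 0 <= s <= M -> `|- (g s)^-1| <= (Num.sqrt (2 * d))^-1.
  move=> sM; rewrite normrN normfV gtr0_norm ?g_gt0//.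
  by rewrite lef_pV2 ?posrE ?g_gt0//; case/andP: (gP s sM).
pose c := a * A `^ (p - 2).
have c0 : 0 < c by rewrite mulr_gt0// powR_gt0.
have structure s1 s2 L : 0 <= s2 -> s2 <= s1 -> s1 <= M -> 0 < L ->
    c * L `^ p * (U s1 - U s2) <=
    H (g s1 * L) / g s1 - H (g s2 * L) / g s2
      + eps * (- (g s2)^-1 - - (g s1)^-1) * L ^+ 2.
  move=> s20 s21 s1M L0.
  have s1M' : 0 <= s1 <= M by rewrite (le_trans s20).
  have s2M' : 0 <= s2 <= M by rewrite s20 (le_trans s21).
  have g10 := g_gt0 _ s1M'; have g20 := g_gt0 _ s2M'.
  have g12 : g s1 <= g s2 by rewrite /g ler_wsqrtr// ler_pM2l//; lra.
  have := slope_growth_scaled (g s2) (g s1) L L0 g10 g12.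
  rewrite ltr0_sg// mulN1r opprB => hH.
  have dg21 : 0 <= eps * (- (g s2)^-1 - - (g s1)^-1) * L ^+ 2.
    rewrite mulr_ge0 ?sqr_ge0// mulr_ge0 ?(ltW eps0)// opprK addrC subr_ge0.
    by rewrite lef_pV2.
  apply: le_trans (_ : _ <= H (g s1 * L) / g s1 - H (g s2 * L) / g s2) _.
    apply: le_trans hH.
    (* On [(0, A]] one has [r^(p-2) >= A^(p-2)], so the gain in powers of [g] dominates the linear
       gain [A^(p-2) (g s2 - g s1)], which is [A^(p-2) (U s1 - U s2)]; this explains [c]. *)
    pose f (r : R) := (p - 1)^-1 * r `^ (p - 1) - A `^ (p - 2) * r.
    have : f (g s1) <= f (g s2).
      apply: (is_derive_ge0_le f (fun r => r `^ (p - 2) - A `^ (p - 2))) => // r;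
        move=> /andP[r1 r2]; have r0 : 0 < r by exact: lt_le_trans r1.
        have dr := is_derive1_powR (p - 1) r0.
        apply: is_derive_eq; rewrite /GRing.scale/=.
        have -> : p - 1 - 1 = p - 2 by ring.
        by field; rewrite lt_eqF.
      have -> : p - 2 = - (2 - p) by ring.
      rewrite !powRN subr_ge0 lef_pV2 ?posrE ?powR_gt0//.
      apply: ge0_ler_powR; rewrite ?nnegrE ?(ltW A0) ?(ltW r0)//; first by lra.
      by apply: le_trans r2 _; case/andP: (gP s2 s2M').
    rewrite /f /U /c => fle.
    have aL : 0 <= a * L `^ p by rewrite mulr_ge0 ?powR_ge0// ltW.
    by have := ler_wpM2l aL fle; lra.
  by rewrite lerDl.
have := transformed_lipschitz_solution H U g (fun s => - (g s)^-1) eps M p c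
  _ _ _ Lip v eps0 p0 c0 gmin0 cH solv v0M vLip dU dgP gP dgD structure x y t t0.
move/le_trans; apply; rewrite le_eqVlt; apply/orP; left; apply/eqP.
rewrite mulrA; congr (_ * _).
have Md0 : 0 <= 2 * (M + d) by rewrite mulr_ge0// addr_ge0// ltW.
have -> : p * c * t = p * A `^ (p - 2) * (a * t) by rewrite /c; ring.
rewrite powRM ?mulr_ge0 ?powR_ge0 ?(ltW p0) ?(ltW a0) ?(ltW t0)//.
rewrite powRM ?powR_ge0 ?(ltW p0)// -powRrM mulrA mulrA.
congr (_ * _).
(* Here [A^2 = 2 (M + d)]: the 2 under the square root is the 2 in [lambda_], and the power [2/p] of
   [A] collects [gmax = A] and the factor [A^(p-2)] of [c]. *)
have -> : (2 / p) `^ p^-1 * (M + d) `^ p^-1 = p `^ (- p^-1) * A `^ (2 / p).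
  rewrite -powRM ?divr_ge0 ?addr_ge0 ?(ltW p0) ?(ltW d0)//.
  have -> : 2 / p * (M + d) = p^-1 * A ^+ 2.
    by rewrite AE sqr_sqrtr//; ring.
  rewrite powRM ?sqr_ge0 ?invr_ge0 ?(ltW p0)//.
  by rewrite -powR_inv1 ?(ltW p0)// -!powRrM mulN1r -powR_mulrn ?(ltW A0)// -powRrM.
rewrite mulrAC mulrC; congr (_ * _).
rewrite -{1}(powRr1 (ltW A0)) -powRD ?(gt_eqF A0) ?implybT//.
by congr (_ `^ _); field.
Qed.

(* The transform is [U = - 2 sqrt (log (A / (v + d)))], for which the quadratic
   term of the transformed equation alone gives a Lipschitz bound that does not
   depend on [d], although [U] blows up as [v + d] tends to [0]. *)
Lemma positivity_propagates x y (t : R) : 1 < p -> 0 < t ->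
  0 < v x t -> 0 < v y t.
Proof.
move=> p_gt1 t0 vx0; have p10 : 0 < p - 1 by rewrite subr_gt0.
have /andP[vy0 vyM] := v0M y t (ltW t0); have /andP[_ vxM] := v0M x t (ltW t0).
have M0 : 0 <= M by apply: le_trans vyM.
rewrite lt_neqAle vy0 andbT; apply/negP => /eqP vyE.
(* For [d <= 1] this constant gives [l - ln (s + d) >= 1], hence [z >= 1] and [g' >= 0]. *)
have [l lE] : exists l, l = 1 + ln (M + 1) by eexists.
have l1 : 1 <= l by rewrite lE lerDl ln_ge0// lerDr.
suff lip d : 0 < d -> d <= 1 ->
    Num.sqrt (l - ln d) <= Num.sqrt (l - ln (v x t))
      + (eps * t) `^ (- 2^-1) * enorm (x - y) / 2.
  have [Z ZE] : exists Z, Z = Num.sqrt (l - ln (v x t))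
      + (eps * t) `^ (- 2^-1) * enorm (x - y) / 2 by eexists.
  (* With [d = exp(- Z^2)] the bound would read [sqrt (l + Z^2) <= Z], which is false as
     [l >= 1]. *)
  have := lip (expR (- Z ^+ 2)) (expR_gt0 _).
  rewrite expRK -ZE -[X in _ <= X -> _]expR0 ler_expR oppr_le0 sqr_ge0 opprK.
  move=> /(_ isT); apply/negP; rewrite -ltNge; apply: le_lt_trans (ler_norm Z) _.
  rewrite -sqrtr_sqr ltr_sqrt; last first.
    by rewrite ltr_wpDr ?sqr_ge0// (lt_le_trans ltr01).
  by rewrite ltrDr (lt_le_trans ltr01).
move=> d0 d1.
have sd s : 0 <= s <= M -> 0 < s + d by move=> /andP[s0 _]; rewrite ltr_wpDl.
have lsd s : 0 <= s <= M -> 1 <= l - ln (s + d).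
  move=> sM; rewrite lE -addrA lerDl subr_ge0.
  by rewrite ler_ln ?posrE ?sd ?ltr_wpDl// lerD//; case/andP: sM.
pose z (s : R) := Num.sqrt (l - ln (s + d)).
have z1 s : 0 <= s <= M -> 1 <= z s.
  by move=> sM; rewrite -[leLHS]sqrtr1 ler_wsqrtr// lsd.
have z_gt0 s : 0 <= s <= M -> 0 < z s.
  by move=> sM; apply: lt_le_trans (z1 s sM).
have z_le s1 s2 : 0 <= s2 -> s2 <= s1 -> s1 <= M -> z s1 <= z s2.
  move=> s20 s21 s1M; rewrite /z ler_wsqrtr// lerD2l lerN2.
  by rewrite ler_ln ?posrE ?lerD2r// sd// ?s20 (le_trans s20, le_trans s21).
pose U (s : R) := - 2 * z s.
pose g (s : R) := (s + d) * z s.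
pose dg (s : R) := z s - (2 * z s)^-1.
have dz (s : R) : 0 <= s <= M -> is_derive s 1 z (- ((2 * z s)^-1 * (s + d)^-1)).
  move=> sM.
  have e1 : is_derive s 1 (fun s : R => s + d) 1.
    by apply: is_derive_eq; rewrite addr0.
  have e2 := @is_derive1_comp R (@ln R) _ s _ _ (is_derive1_ln (sd s sM)) e1.
  have e3 : is_derive s 1 (fun s : R => l - ln (s + d)) (- (s + d)^-1).
    by apply: is_derive_eq; rewrite /GRing.scale/=; ring.
  have e4 := is_derive1_sqrt (lt_le_trans ltr01 (lsd s sM)).
  by apply: (is_derive_eq (@is_derive1_comp R _ _ s _ _ e4 e3)); rewrite mulrN.
have dU (s : R) : 0 <= s <= M -> is_derive s 1 U (g s)^-1.
  move=> sM; have e1 := dz s sM; apply: is_derive_eq.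
  rewrite /GRing.scale/= /g; field.
  by rewrite !gt_eqF ?sd ?z_gt0.
have dgP (s : R) : 0 <= s <= M -> is_derive s 1 g (dg s).
  move=> sM; have e1 := dz s sM; apply: is_derive_eq.
  rewrite /GRing.scale/= /dg; field.
  by rewrite !gt_eqF ?sd ?z_gt0.
have O0M : 0 <= (0 : R) <= M by rewrite lexx.
have gP (s : R) : 0 <= s <= M -> d <= g s <= (M + d) * z 0.
  move=> sM; have /andP[s0 sM'] := sM; apply/andP; split.
    rewrite /g -[leLHS]mulr1; apply: ler_pM => //; first exact: ltW.
      by rewrite lerDr.
    exact: z1.
  by apply: ler_pM; rewrite ?(ltW (sd s sM)) ?(ltW (z_gt0 s sM)) ?lerD2r ?z_le.
have dg_ge0 (s : R) : 0 <= s <= M -> 0 <= dg s.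
  move=> sM; have := z1 s sM; rewrite /dg => zs.
  rewrite subr_ge0; apply: le_trans zs; rewrite invf_le1 ?mulr_gt0 ?z_gt0//.
  by have := z1 s sM; lra.
have dgD (s : R) : 0 <= s <= M -> `|dg s| <= z 0.
  move=> sM; rewrite ger0_norm ?dg_ge0// /dg lerBlDr.
  have /andP[s0 sM'] := sM; apply: le_trans (z_le s 0 (lexx _) s0 sM') _.
  by rewrite lerDl invr_ge0 mulr_ge0// ltW// z_gt0.
(* Here [k = 2]. The Hamiltonian part is nonnegative since [g] increases and [H(r) / r] is
   nondecreasing; the gain is [dg s2 - dg s1 >= z s2 - z s1], which equals half of [U s1 - U s2],
   hence the constant [eps / 2]. *)
have structure s1 s2 L : 0 <= s2 -> s2 <= s1 -> s1 <= M -> 0 < L ->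
    eps / 2 * L `^ 2 * (U s1 - U s2) <=
    H (g s1 * L) / g s1 - H (g s2 * L) / g s2 + eps * (dg s2 - dg s1) * L ^+ 2.
  move=> s20 s21 s1M L0.
  have s1M' : 0 <= s1 <= M by rewrite (le_trans s20).
  have s2M' : 0 <= s2 <= M by rewrite s20 (le_trans s21).
  have g20 : 0 < g s2 by rewrite mulr_gt0 ?sd ?z_gt0.
  have g21 : g s2 <= g s1.
    apply: (is_derive_ge0_le g dg) => // s /andP[h1 h2].
      by apply: dgP; rewrite (le_trans s20 h1) (le_trans h2).
    by apply: dg_ge0; rewrite (le_trans s20 h1) (le_trans h2).
  have := slope_growth_scaled (g s1) (g s2) L L0 g20 g21.
  rewrite gtr0_sg// mul1r => hH.
  have {}hH : 0 <= H (g s1 * L) / g s1 - H (g s2 * L) / g s2.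
    apply: le_trans hH; rewrite mulr_ge0 ?divr_ge0 ?(ltW a0) ?(ltW p10)//.
    rewrite mulr_ge0 ?powR_ge0// subr_ge0.
    apply: ge0_ler_powR; rewrite ?nnegrE ?(ltW g20) ?(ltW p10)//.
    by rewrite (le_trans (ltW g20)).
  have z12 : (2 * z s2)^-1 <= (2 * z s1)^-1.
    by rewrite lef_pV2 ?posrE ?mulr_gt0 ?z_gt0// ler_pM2l// z_le.
  have : 0 <= eps * L ^+ 2 * ((2 * z s1)^-1 - (2 * z s2)^-1).
    by rewrite mulr_ge0 ?subr_ge0// mulr_ge0 ?sqr_ge0// ltW.
  rewrite powR_mulrn ?(ltW L0)// /U /dg.
  move: hH; move: (H _ / _ - _) ((2 * z s1)^-1) ((2 * z s2)^-1) => h i1 i2.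
  by lra.
have e20 : 0 < eps / 2 by rewrite divr_gt0.
have := transformed_lipschitz H U g dg eps M 2 (eps / 2) _ _ _ Lip v eps0
  (ltr0n R 2) e20 d0 cH solv v0M vLip dU dgP gP dgD structure x y t t0.
have -> : 2 * (eps / 2) * t = eps * t by field.
rewrite /U -vyE /z add0r.
have : Num.sqrt (l - ln (v x t + d)) <= Num.sqrt (l - ln (v x t)).
  by rewrite ler_wsqrtr// lerD2l lerN2 ler_ln ?posrE ?addr_gt0// lerDl ltW.
by lra.
Qed.

End Estimates.

(** * Removal of the shift and the final estimates *)

Section SolutionEstimates.
Context {R : realType} {N : nat}.
Variables (p a b gamma eps : R) (H : R -> R) (Phi : R -> R -> R).
Variables (phi : 'rV[R]_N -> R) (v : 'rV[R]_N -> R -> R).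
Hypotheses (N0 : (0 < N)%N) (p0 : 0 < p) (p1 : p != 1) (eps0 : 0 < eps).
Hypotheses (phiC2 : C2b phi) (basicH : basic_assumption H Phi).
Hypotheses (pcondH : p_condition p Phi a b gamma).
Hypothesis solv : solution H eps phi v.

Let M := fine (Linf_norm phi).

Let a0 : 0 < a. Proof. by case: pcondH. Qed.
Let cH : {within `[0, +oo[, continuous H}. Proof. by case: basicH => -[]. Qed.
Let regv := solution_regular H eps phi v solv.
Let lam0 : 0 < lambda_ p.
Proof. by rewrite /lambda_; case: ifP => // _; rewrite powR_gt0// divr_gt0. Qed.

Lemma solution_bounded x (t : R) : 0 <= t -> 0 <= v x t <= M.
Proof.
have [[_ [B [_ phiB]]] _ _] := phiC2; have [_ _ _ vM _] := solv => t0.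
(* [fine] sends infinite values to 0, so finiteness must precede the real-valued bound. *)
have Linf_fin : Linf_norm phi \is a fin_num.
  rewrite fin_numElt; apply/andP; split.
    have [h1 h2] := vM 0 0 (lexx _); apply: lt_le_trans h2.
    exact: ltNyr.
  apply: (@le_lt_trans _ _ (B + 1)%:E); last exact: ltry.
  by apply: Linf_norm_le => // z; apply: phiB => //; rewrite ltrDl.
by have [-> h2] := vM x t t0; rewrite -lee_fin fineK.
Qed.

Let M0 : 0 <= M.
Proof. by have /andP[/le_trans h /h] := solution_bounded 0 0 (lexx _). Qed.

Lemma solution_initial_lipschitz :
  exists Lip, forall x y, v x 0 - v y 0 <= Lip * enorm (x - y).
Proof.
have [_ dphi _] := phiC2; have [_ _ v0 _ _] := solv.
have bphi i : bounded_fun (partial i phi) by case: (dphi i).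
have [|Lip LipP] := lipschitz_of_partial phi _ bphi.
  by move=> i z; apply: derivableP; have [+ _ _] := dphi i; apply.
by exists Lip => x y; rewrite !v0.
Qed.

Lemma cvg_powR_shift (r m : R) : 0 <= r -> 0 < m ->
  (r + d) `^ m @[d --> 0^'+] --> r `^ m.
Proof.
move=> r0 m0; have [->|rN0] := eqVneq r 0.
  rewrite powR0 ?gt_eqF//; under eq_fun do rewrite add0r.
  exact: powR_cvg0.
have r_gt0 : 0 < r by rewrite lt_neqAle eq_sym rN0.
apply: cvg_at_right_filter.
have cr : {for r, continuous (fun s : R => s `^ m)}.
  apply/differentiable_continuous/derivable1_diffP.
  by case: (is_derive1_powR m r_gt0).
have : (r + d) @[d --> (0 : R)] --> r.
  by rewrite -[X in _ --> X]addr0; apply: cvgD; [exact: cvg_cst|exact: cvg_id].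
by move/(cvg_comp _ _)/(_ cr).
Qed.

Definition lip_bound (t : R) := lambda_ p * M `^ p^-1 * (a * t) `^ (- p^-1).

Lemma lip_bound_ge0 t : 0 <= lip_bound t.
Proof. by rewrite /lip_bound !mulr_ge0 ?powR_ge0// ltW. Qed.

Lemma solution_lipschitz x y (t : R) : 0 < t ->
  v x t - v y t <= lip_bound t * enorm (x - y).
Proof.
move=> t0; have [Lip LipP] := solution_initial_lipschitz.
have lim : lambda_ p * (M + d) `^ p^-1 * (a * t) `^ (- p^-1) * enorm (x - y)
    @[d --> 0^'+] --> lip_bound t * enorm (x - y).
  apply: cvgMr_tmp; apply: cvgMr_tmp; apply: cvgMl_tmp.
  by apply: cvg_powR_shift; rewrite ?invr_gt0.
apply: (cvgr_to_ge lim); near=> d.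
have d0 : 0 < d by near: d; exact: nbhs_right_gt.
rewrite /lambda_; case: ifP => [p_gt1|/negbT]; last first.
  rewrite -leNgt le_eqVlt (negbTE p1)/= => p_lt1.
  exact: (lipschitz_lt1 _ _ _ _ _ _ _ _ _ _ p0 p1 eps0 basicH pcondH regv
    solution_bounded LipP).
rewrite mul1r.
by have [] := lipschitz_gt1 _ _ _ _ _ _ _ _ _ _ p0 p1 eps0 basicH pcondH regv
  solution_bounded LipP d x y t p_gt1 d0 t0.
Unshelve. all: by end_near. Qed.

Lemma solution_pow_lipschitz x y (t : R) : 1 < p -> 0 < t ->
  v x t `^ ((p - 1) / p) - v y t `^ ((p - 1) / p) <=
  mu_ p a * t `^ (- p^-1) * enorm (x - y).
Proof.
move=> p_gt1 t0; have [Lip LipP] := solution_initial_lipschitz.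
have m0 : 0 < (p - 1) / p by rewrite divr_gt0// subr_gt0.
have /andP[x0 _] := solution_bounded x t (ltW t0).
have /andP[y0 _] := solution_bounded y t (ltW t0).
have lim : (v x t + d) `^ ((p - 1) / p) - (v y t + d) `^ ((p - 1) / p)
    @[d --> 0^'+] --> v x t `^ ((p - 1) / p) - v y t `^ ((p - 1) / p).
  exact: (cvgB (cvg_powR_shift _ _ x0 m0) (cvg_powR_shift _ _ y0 m0)).
apply: (cvgr_to_le lim); near=> d.
have d0 : 0 < d by near: d; exact: nbhs_right_gt.
by have [] := lipschitz_gt1 _ _ _ _ _ _ _ _ _ _ p0 p1 eps0 basicH pcondH regv
  solution_bounded LipP d x y t p_gt1 d0 t0.
Unshelve. all: by end_near. Qed.

Lemma continuous_slice (f : 'rV[R]_N -> R -> R) (t : R) : 0 <= t ->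
  continuous_half_space f -> continuous (f ^~ t).
Proof.
move=> t0 cf; pose slice (x : 'rV[R]_N) : 'rV[R]_N * R := (x, t).
have cid : continuous (fun x : 'rV[R]_N => x) by move=> x; exact: cvg_id.
have ccst : continuous (fun _ : 'rV[R]_N => t) by exact: cst_continuous.
exact: (continuous_within_comp _ _ slice cf (continuous_pairing _ _ cid ccst)
  (fun=> t0)).
Qed.

Lemma solution_partial_continuous i (t : R) : 0 <= t ->
  continuous (partial i (v ^~ t)).
Proof.
move=> t0; have [[_ dv _ _] _ _ _ _] := solv; have [_ cdv] := dv i.
exact: continuous_slice cdv.
Qed.

Lemma solution_grad_le x (t : R) : 0 < t ->
  enorm (grad (v ^~ t) x) <= lip_bound t.
Proof.
move=> t0; have [_ dv _ _] := regv.
apply: enorm_grad_le => [i z|i||y z].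
- exact/dv/ltW.
- exact/solution_partial_continuous/ltW.
- exact: lip_bound_ge0.
- exact: solution_lipschitz.
Qed.

(** By propagation of positivity, either [v] vanishes identically at time [t] and [w] is constant,
    or [v] is positive everywhere and the power may be differentiated. *)
Lemma solution_pow_grad (t : R) : 1 < p -> 0 < t ->
  let w := fun x : 'rV[R]_N => v x t `^ ((p - 1) / p) in
  (forall x i, has_partial i w x) /\
  (forall x, enorm (grad w x) <= mu_ p a * t `^ (- p^-1)).
Proof.
move=> p_gt1 t0 w; have [_ dv _ _] := regv.
have mu0 : 0 <= mu_ p a * t `^ (- p^-1).
  rewrite mulr_ge0 ?powR_ge0// /mu_ divr_ge0 ?(ltW p0)//.
  by rewrite mulr_ge0 ?powR_ge0// subr_ge0 ltW.
have m0 : 0 < (p - 1) / p by rewrite divr_gt0// subr_gt0.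
have [[z vz]|vneg] := pselect (exists z, 0 < v z t); last first.
  have w0 : w = cst 0.
    apply/funext => x; rewrite /w/=.
    have /andP[vx _] := solution_bounded x t (ltW t0).
    have [->|vN0] := eqVneq (v x t) 0; first by rewrite powR0// gt_eqF.
    by exfalso; apply: vneg; exists x; rewrite lt_neqAle eq_sym vN0.
  rewrite w0; split; first by move=> x i; exact: derivable_cst.
  move=> x; rewrite (_ : grad _ x = 0) ?enorm0//.
  by apply/rowP => i; rewrite !mxE /partial derive_cst.
have [Lip LipP] := solution_initial_lipschitz.
have vpos x : 0 < v x t.
  exact: (positivity_propagates _ _ _ _ _ _ _ _ _ _ p0 p1 eps0 basicH pcondH
    regv solution_bounded LipP z x t p_gt1 t0 vz).
have dw i x : is_derive x (delta_mx 0 i) w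
    ((p - 1) / p * v x t `^ ((p - 1) / p - 1) * partial i (v ^~ t) x).
  exact: (is_derive_chain _ _ _ _ _ _ (is_derive1_powR _ (vpos x))
    (dv i x t (ltW t0))).
have pw i : partial i w = (fun x => (p - 1) / p * v x t `^ ((p - 1) / p - 1)
    * partial i (v ^~ t) x).
  by apply/funext => x; rewrite /partial; have [_ ->] := dw i x.
split; first by move=> x i; case: (dw i x).
have cv : continuous (v ^~ t).
  by have [[cv _ _ _] _ _ _ _] := solv; exact: continuous_slice (ltW t0) cv.
move=> x; apply: enorm_grad_le => [i y|i|//|y y'].
- by rewrite pw; exact: dw.
- rewrite pw => y.
  have cp : {for v y t, continuous (fun s : R => s `^ ((p - 1) / p - 1))}.
    apply/differentiable_continuous/derivable1_diffP.
    by case: (is_derive1_powR ((p - 1) / p - 1) (vpos y)).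
  have cvp := continuous_comp (cv y) cp.
  exact: (cvgM (cvgMl_tmp cvp) (solution_partial_continuous i t (ltW t0) y)).
- exact: solution_pow_lipschitz.
Qed.

Definition time_error (t : R) :=
  2 `^ ((p + 1) / p) * N%:R * lambda_ p * M `^ p^-1 * a `^ (- p^-1)
    * eps `^ 2^-1 * t `^ (- ((p + 2) / (2 * p))).

(** Origin of the constant: in [2^((p+1)/p) = 2 * 2^(1/p)], the factor [2^(1/p)] comes from the
    gradient bound at time [t / 2]. *)
Lemma time_errorE t : 0 < t -> time_error t =
  2 * N%:R * lip_bound (t / 2) * (eps `^ 2^-1 * t `^ (- 2^-1)).
Proof.
move=> t0; have t0' := ltW t0; rewrite /time_error /lip_bound.
have two0 : 0 < 2 :> R by [].
have -> : (p + 1) / p = 1 + p^-1 by field; rewrite gt_eqF.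
have -> : - ((p + 2) / (2 * p)) = - p^-1 + - 2^-1 by field; rewrite gt_eqF.
rewrite !powRD ?(gt_eqF two0) ?(gt_eqF t0) ?implybT// powRr1//.
have -> : (a * (t / 2)) `^ (- p^-1) = a `^ (- p^-1) * t `^ (- p^-1) * 2 `^ p^-1.
  rewrite powRM ?divr_ge0 ?(ltW a0)// powRM ?invr_ge0// mulrA.
  by congr (_ * _); rewrite -[X in X `^ _]powR_inv1// -powRrM mulrNN mul1r.
by ring.
Qed.

(** With [s = sqrt (eps / t)] and [B = G / (s t)] the two terms become [G s / 2] and [N G s / 2],
    and [N >= 1] bounds their sum by [2 N G s]. If [G = 0] this [B] is 0, so arbitrarily small [B]
    are used. *)
Lemma time_error_optimal (G l h t : R) : 0 <= G -> 0 < t ->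
  (forall B, 0 < B ->
    l <= G ^+ 2 / (4 * B * (t - t / 2)) + N%:R * B * eps / 2 + h) ->
  l <= 2 * N%:R * G * (eps `^ 2^-1 * t `^ (- 2^-1)) + h.
Proof.
move=> G0 t0 lB; have N1 : 1 <= N%:R :> R by rewrite ler1n.
have Npos : 0 < N%:R :> R by rewrite ltr0n.
have [s sE] : exists s, s = eps `^ 2^-1 * t `^ (- 2^-1) by eexists.
rewrite -sE; have s0 : 0 < s by rewrite sE mulr_gt0 ?powR_gt0.
have s2 : s ^+ 2 * t = eps.
  rewrite sE exprMn -!powR_mulrn ?powR_ge0// -!powRrM mulNr mulVf//.
  by rewrite powRr1 ?(ltW eps0)// powR_inv1 ?(ltW t0)// divfK// gt_eqF.
have [G00|GN0] := eqVneq G 0.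
  rewrite G00 mulr0 mul0r add0r; apply/ler_addgt0Pr => e e0.
  have Ne : 0 < N%:R * eps by rewrite mulr_gt0.
  have := lB (2 * e / (N%:R * eps)) _; rewrite divr_gt0 ?mulr_gt0// => /(_ isT).
  rewrite G00 expr0n mul0r add0r.
  have -> : N%:R * (2 * e / (N%:R * eps)) * eps / 2 = e.
    by field; rewrite !gt_eqF.
  by rewrite addrC.
have Gpos : 0 < G by rewrite lt_neqAle eq_sym GN0.
have B0 : 0 < G / (s * t) by rewrite divr_gt0// mulr_gt0.
apply: le_trans (lB _ B0) _; rewrite lerD2r -s2.
have -> : G ^+ 2 / (4 * (G / (s * t)) * (t - t / 2)) = G * s / 2.
  by field; rewrite !gt_eqF.
have -> : N%:R * (G / (s * t)) * (s ^+ 2 * t) / 2 = N%:R * (G * s) / 2.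
  by field; rewrite !gt_eqF.
have Gs : 0 < G * s by rewrite mulr_gt0.
have := ler_wpM2r (ltW Gs) N1; lra.
Qed.

Let K0 : 0 < M + 1. Proof. by rewrite ltr_wpDl. Qed.

Lemma solution_time_derivative x (t : R) : 0 < t ->
  is_derive t 1 (v x) (derive1 (v x) t).
Proof.
move=> t0; have [_ _ _ dvt] := regv.
by have dvtx := dvt x t t0; rewrite derive1E derive_val.
Qed.

Lemma solution_time_derivative_le x (t : R) : 0 < t ->
  derive1 (v x) t <= time_error t.
Proof.
move=> t0; have t20 : 0 < t / 2 by rewrite divr_gt0.
have tt : t / 2 < t by lra.
rewrite time_errorE// -[leRHS]addr0.
apply: time_error_optimal => //; first exact: lip_bound_ge0.
move=> B B0.
apply: (time_derivative_le H eps (M + 1) 0 (t / 2) (lip_bound (t / 2)) v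
  eps0 (ltW t20) K0 (lexx _) cH regv _ _ _ x t _ B tt B0
  (solution_time_derivative x t t0)).
- move=> y z r s r0 s0; have /andP[_ h1] := solution_bounded y r r0.
  by have /andP[h2 _] := solution_bounded z s s0; lra.
- by move=> y z; exact: solution_lipschitz.
- move=> y s _; rewrite oppr_le0; have [[H0 _ _ _] _ _] := basicH.
  exact/H0/enorm_ge0.
Qed.

(** The upper bound is applied to [- v]. Now [h] has to bound [H] at the gradients occurring after
    time [t / 2], all of length at most [lip_bound (t / 2)] because that bound decreases in time. *)
Lemma solution_time_derivative_ge (h : R) x (t : R) : 0 < t -> 0 <= h ->
  (forall r, 0 <= r <= lip_bound (t / 2) -> H r <= h) ->
  - h - time_error t <= derive1 (v x) t.
Proof.
move=> t0 h0 Hh; have t20 : 0 < t / 2 by rewrite divr_gt0.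
have tt : t / 2 < t by lra.
suff : - derive1 (v x) t <= time_error t + h by lra.
rewrite time_errorE//; apply: time_error_optimal => //.
  exact: lip_bound_ge0.
move=> B B0.
have cNH : {within `[0, +oo[, continuous (fun r => - H r)}.
  by move=> r; apply: cvgN; exact: cH.
have dNv : is_derive t 1 (fun s => - v x s) (- derive1 (v x) t).
  by have := solution_time_derivative x t t0 => ?; exact: is_deriveN.
apply: (time_derivative_le (fun r => - H r) eps (M + 1) h (t / 2)
  (lip_bound (t / 2)) (fun x s => - v x s) eps0 (ltW t20) K0 h0 cNH
  (regular_solutionN _ _ _ regv) _ _ _ x t _ B tt B0 dNv).
- move=> y z r s r0 s0; have /andP[h1 _] := solution_bounded y r r0.
  by have /andP[_ h2] := solution_bounded z s s0; lra.
- move=> y z; rewrite opprK addrC -enormN opprB.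
  exact: solution_lipschitz.
- move=> y s ts; have s0 : 0 < s by exact: lt_trans ts.
  have [_ dv _ _] := regv.
  have -> : grad (fun y => - v y s) y = - grad (v ^~ s) y.
    apply/rowP => i; rewrite !mxE; apply: partialN.
    by case: (dv i y s (ltW s0)).
  rewrite opprK enormN; apply: Hh; rewrite enorm_ge0/=.
  apply: le_trans (solution_grad_le y s s0) _.
  rewrite /lip_bound ler_wpM2l ?mulr_ge0 ?powR_ge0 ?(ltW lam0)//.
  rewrite !powRN lef_pV2 ?posrE ?powR_gt0 ?mulr_gt0//.
  apply: ge0_ler_powR; first by rewrite invr_ge0 ltW.
  - by rewrite nnegrE ltW// mulr_gt0.
  - by rewrite nnegrE ltW// mulr_gt0.
  - by rewrite ler_pM2l// ltW.
Qed.

Lemma lip_bound_pow (t k : R) : 0 < t -> 0 < k ->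
  lip_bound (t / 2) `^ k =
  (2 * lambda_ p `^ p * M * a^-1) `^ (k / p) * t `^ (- (k / p)).
Proof.
move=> t0 k0; have t0' := ltW t0.
have -> : lip_bound (t / 2) = (2 * lambda_ p `^ p * M * a^-1 * t^-1) `^ p^-1.
  have -> : 2 * lambda_ p `^ p * M * a^-1 * t^-1 =
      lambda_ p `^ p * M * (a * (t / 2))^-1.
    by field; rewrite !gt_eqF.
  have at0 : 0 <= a * (t / 2) by rewrite mulr_ge0 ?divr_ge0 ?(ltW a0).
  rewrite powRM ?mulr_ge0 ?powR_ge0 ?invr_ge0//.
  rewrite powRM ?powR_ge0// -powRrM mulfV ?gt_eqF// powRr1 ?(ltW lam0)//.
  by rewrite -[(_ * _)^-1]powR_inv1// -powRrM mulN1r.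
rewrite -powRrM [p^-1 * k]mulrC powRM ?invr_ge0//; last first.
  by rewrite !mulr_ge0 ?powR_ge0 ?invr_ge0// ltW.
by congr (_ * _); rewrite -[X in X `^ _]powR_inv1// -powRrM mulN1r.
Qed.

Lemma solution_time_derivative_ge_growth (gH kinf k0 : R) x (t : R) :
  0 < gH -> 0 < kinf -> kinf <= k0 ->
  (forall r, 0 < r -> H r <= gH * (r `^ kinf + r `^ k0)) -> 0 < t ->
  let mu := if t <= 1 then k0 / p else kinf / p in
  let K := 2 * lambda_ p `^ p * M * a^-1 in
  let L := gH * (K `^ (k0 / p) + K `^ (kinf / p)) in
  - L * t `^ (- mu) - time_error t <= derive1 (v x) t.
Proof.
move=> gH0 kinf0 k0inf HH t0; lazy zeta; set K := 2 * _ * M * _.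
have k00 := lt_le_trans kinf0 k0inf.
pose G := lip_bound (t / 2).
have [[_ _ H00 _] _ _] := basicH.
have := solution_time_derivative_ge (gH * (G `^ kinf + G `^ k0)) x t t0.
have h0 : 0 <= gH * (G `^ kinf + G `^ k0).
  by rewrite mulr_ge0 ?addr_ge0 ?powR_ge0// ltW.
move=> /(_ h0) dge; apply: (le_trans _ (dge _)); last first.
  move=> r /andP[r0 rG]; have [->|rN0] := eqVneq r 0; first by rewrite H00.
  have r_gt0 : 0 < r by rewrite lt_neqAle eq_sym rN0.
  apply: le_trans (HH r r_gt0) _; rewrite ler_pM2l//; apply: lerD.
    by apply: ge0_ler_powR; rewrite ?nnegrE ?(ltW kinf0)// lip_bound_ge0.
  by apply: ge0_ler_powR; rewrite ?nnegrE ?(ltW k00)// lip_bound_ge0.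
rewrite lerD2r mulNr lerN2 -mulrA ler_pM2l// addrC mulrDl.
rewrite /G !lip_bound_pow// -/K.
have kp : kinf / p <= k0 / p by rewrite ler_pM2r ?invr_gt0.
(* Of the two powers of [t], the larger replaces both: it has exponent [- k0 / p] for [t <= 1] and
   [- kinf / p] for [t > 1]. *)
case: ifPn => [t1|]; last rewrite -ltNge => t1.
  rewrite lerD2l ler_wpM2l ?powR_ge0//.
  by apply: ger_powR; rewrite ?t0// lerN2.
rewrite lerD2r ler_wpM2l ?powR_ge0//.
by apply: ler_powR; rewrite ?lerN2// ltW.
Qed.

End SolutionEstimates.

Theorem proposition4p3 (R : realType) (N : nat) (p : R) :
  (0 < N)%N -> 0 < p -> p != 1 ->
  exists2 eps0 : R, 0 < eps0 &
  forall (phi : 'rV[R]_N -> R) (H : R -> R) (Phi : R -> R -> R)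
    (a b gamma eps : R) (v : 'rV[R]_N -> R -> R),
  C2b phi -> (forall x, 0 <= phi x) ->
  basic_assumption H Phi -> p_condition p Phi a b gamma ->
  0 < eps -> solution H eps phi v ->
  let M := fine (Linf_norm phi) in
  let err := fun t : R =>
    2 `^ ((p + 1) / p) * N%:R * lambda_ p * M `^ p^-1 * a `^ (- p^-1)
      * eps `^ 2^-1 * t `^ (- ((p + 2) / (2 * p))) in
  [/\ forall t, 0 < t ->
        (grad_norm (v ^~ t)
          <= (lambda_ p * M `^ p^-1 * (a * t) `^ (- p^-1))%R%:E)%E,
      1 < p -> forall t, 0 < t ->
        let w := fun x : 'rV[R]_N => v x t `^ ((p - 1) / p) in
        (forall x i, has_partial i w x) /\
        (grad_norm w <= (mu_ p a * t `^ (- p^-1))%R%:E)%E,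
      eps < eps0 -> forall x t, 0 < t -> derive1 (v x) t <= err t
    & forall gH kinf k0 : R, 0 < gH -> 0 < kinf -> kinf <= k0 ->
        (forall r, 0 < r -> H r <= gH * (r `^ kinf + r `^ k0)) ->
        eps < eps0 -> forall x t, 0 < t ->
        let mu := if t <= 1 then k0 / p else kinf / p in
        let K := 2 * lambda_ p `^ p * M * a^-1 in
        let L := gH * (K `^ (k0 / p) + K `^ (kinf / p)) in
        - L * t `^ (- mu) - err t <= derive1 (v x) t].
Proof.
move=> N0 p0 p1; exists 1 => // phi H Phi a b gamma eps v phiC2 _ basicH pcondH.
move=> eps0 solv M err; split.
- move=> t t0; apply: grad_norm_le => // x.
  exact: (solution_grad_le _ _ _ _ _ _ _ _ _ N0 p0 p1 eps0 phiC2 basicH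
    pcondH solv).
- move=> p_gt1 t t0 w.
  have [dw wP] := solution_pow_grad _ _ _ _ _ _ _ _ _ N0 p0 p1 eps0 phiC2
    basicH pcondH solv t p_gt1 t0.
  by split=> //; exact: grad_norm_le.
- move=> _ x t t0.
  exact: (solution_time_derivative_le _ _ _ _ _ _ _ _ _ N0 p0 p1 eps0 phiC2
    basicH pcondH solv).
- move=> gH kinf k0 gH0 kinf0 k0inf HH _ x t t0.
  exact: (solution_time_derivative_ge_growth _ _ _ _ _ _ _ _ _ N0 p0 p1 eps0
    phiC2 basicH pcondH solv gH kinf k0 x t gH0 kinf0 k0inf HH t0).
Qed.
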